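(* Let $\sigma\ge 0$ and let $V,\gamma,\varepsilon>0$ satisfy \[ \sqrt{\tfrac{1+\sigma}{\sigma}}<\frac{V+\gamma\varepsilon}{\sqrt{\sigma}}<\zeta_\sigma \quad\text{if } \sigma>0,\qquad 1<V+\gamma\varepsilon<\zeta_0\quad\text{if }\sigma=0. \] Then the system \[ -(V+\gamma\varepsilon)n'+(nu)'=0,\qquad -(V+\gamma\varepsilon)u'+uu'+\sigma\frac{n'}{n}=-\phi',\qquad \varepsilon\phi''=e^{\phi}-n, \] for unknown functions $(n,u,\phi)$ of $\xi\in\mathbb{R}$ (with $'=d/d\xi$), together with the far-field condition $n\to1$, $u\to0$, $\phi\to0$ as $|\xi|\to\infty$, admits a non-trivial smooth solution $(n,u,\phi)$, which is unique up to translation $\xi\mapsto\xi-\xi_c$. Moreover, after an appropriate translation, this solution satisfies: (i) $n(\xi)=n(-\xi)$, $u(\xi)=u(-\xi)$, $\phi(\xi)=\phi(-\xi)$ for all $\xi\in\mathbb{R}$; (ii) $n'(\xi),u'(\xi),\phi'(\xi)<0$ for all $\xi\in(0,\infty)$; (iii) $(n,u,\phi)$ attains its maximum values at $\xi=0$; and (iv) $n(\xi)>1$, $u(\xi)>0$, $\phi(\xi)>0$ for all $\xi\in\mathbb{R}$.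
   Context: For $\sigma>0$, $\zeta_\sigma$ denotes the unique root $z>1$ of $z^{\sigma}[\sigma(z-1)^2+1]=\exp(\tfrac{\sigma}{2}(z^2-1))$ on $(1,\infty)$ (one has $\zeta_\sigma>\sqrt{(1+\sigma)/\sigma}$, and the left side exceeds the right side for $z\in(1,\zeta_\sigma)$). $\zeta_0$ denotes the unique positive root of $z^2+1=\exp(z^2/2)$. This system is the traveling-wave reduction of the one-dimensional Euler–Poisson system $\partial_t n+\partial_x(nu)=0$, $\partial_t u+u\partial_x u+\sigma\partial_x n/n=-\partial_x\phi$, $\partial_x^2\phi=e^\phi-n$ in the variable $\xi=\varepsilon^{1/2}(x-(V+\gamma\varepsilon)t)$. *)

(* Defs.v *)
From Stdlib Require Import Reals.
From Coquelicot Require Import Coquelicot.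
Open Scope R_scope.

Definition smooth (f : R -> R) : Prop :=
  forall (k : nat) (x : R), ex_derive_n f k x.

Definition zeta_eq (sigma z : R) : Prop :=
  Rpower z sigma * (sigma * (z - 1) ^ 2 + 1) = exp (sigma / 2 * (z ^ 2 - 1)).

Definition is_zeta_sigma (sigma z : R) : Prop :=
  1 < z /\ zeta_eq sigma z /\ (forall w, 1 < w -> zeta_eq sigma w -> w = z).

Definition zeta0_eq (z : R) : Prop := z ^ 2 + 1 = exp (z ^ 2 / 2).

Definition is_zeta0 (z : R) : Prop :=
  0 < z /\ zeta0_eq z /\ (forall w, 0 < w -> zeta0_eq w -> w = z).

Definition speed_condition (sigma c : R) : Prop :=
  (0 < sigma -> exists zeta, is_zeta_sigma sigma zeta /\
       sqrt ((1 + sigma) / sigma) < c / sqrt sigma /\ c / sqrt sigma < zeta) /\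
  (sigma = 0 -> exists zeta, is_zeta0 zeta /\ 1 < c /\ c < zeta).

(* (n,u,phi) is a smooth solution of the traveling-wave system with speed c
   and the far-field conditions.  n is a (positive) density, so that n'/n
   makes sense. *)
Definition is_tw_solution (sigma c eps : R) (n u phi : R -> R) : Prop :=
  smooth n /\ smooth u /\ smooth phi /\
  (forall x, 0 < n x) /\
  (forall x, - c * Derive n x + Derive (fun y => n y * u y) x = 0) /\
  (forall x, - c * Derive u x + u x * Derive u x + sigma * (Derive n x / n x)
             = - Derive phi x) /\
  (forall x, eps * Derive_n phi 2 x = exp (phi x) - n x) /\
  is_lim n p_infty 1 /\ is_lim n m_infty 1 /\
  is_lim u p_infty 0 /\ is_lim u m_infty 0 /\
  is_lim phi p_infty 0 /\ is_lim phi m_infty 0.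

Definition nontrivial (n u phi : R -> R) : Prop :=
  exists x, n x <> 1 \/ u x <> 0 \/ phi x <> 0.

(* Main.v *)
(** Write [c = V + gamma eps] and [s = sigma]. The far-field conditions fix the
    constants in the conservation laws, so that [u = c (1 - 1/n)],
    [phi = H(n)] with [H = potential c s], and [eps phi'^2 / 2 = G(n)] with
    [G = energy c s]. Here [G(1) = 0] and [G' = H' (exp H - n)], and [n = 1] is
    a saddle. The upper bound on the speed says exactly that [G] becomes
    negative before the sonic point [n = c / sqrt s] (at infinity if [s = 0]),
    so [G] has a first zero [m > 1] there, which is the height of the wave.

    Existence is a quadrature: [n = 1 + (m - 1) / cosh w] desingularizes
    [eps phi'^2 / 2 = G(n)] into [w' = 1 / theta(w)]. Smoothness follows by
    bootstrapping the first-order system for [(n, phi, phi')].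

    For uniqueness, [G(n) >= 0] along any solution: [n] cannot cross the
    interval just above [m] where [G < 0], and it cannot have a minimum
    below [1] since [G > 0] on [(0, 1)]. Hence [1 <= n <= m], the maximum of a
    nontrivial solution equals [m], and Gronwall's inequality for
    [(phi, phi')] identifies it with the translated wave. *)

Require Import Defs.
From Stdlib Require Import Reals Ranalysis5 Lra.
From Coquelicot Require Import Coquelicot.
Open Scope R_scope.

(** * Calculus *)

Lemma mvt (f f' : R -> R) (a b : R) :
  a < b -> (forall x, a <= x <= b -> is_derive f x (f' x)) ->
  exists x, a < x < b /\ f b - f a = f' x * (b - a).
Proof.
  intros Hab Hf.
  destruct (MVT_cor2 f f' a b Hab) as [x [Hx1 Hx2]].
  - intros x Hx. apply is_derive_Reals. now apply Hf.
  - now exists x.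
Qed.

Lemma is_derive_continuity_pt (f : R -> R) (x l : R) :
  is_derive f x l -> continuity_pt f x.
Proof.
  intros H. apply derivable_continuous_pt. exists l. now apply is_derive_Reals.
Qed.

Lemma is_derive_eq (f : R -> R) (x l l' : R) :
  is_derive f x l -> l = l' -> is_derive f x l'.
Proof. now intros H <-. Qed.

Lemma is_derive_Rplus (f g : R -> R) (x f' g' : R) :
  is_derive f x f' -> is_derive g x g' ->
  is_derive (fun y : R => f y + g y) x (f' + g').
Proof. apply (is_derive_plus f g). Qed.

Lemma is_derive_Rmult (f g : R -> R) (x f' g' : R) :
  is_derive f x f' -> is_derive g x g' ->
  is_derive (fun y : R => f y * g y) x (f' * g x + f x * g').
Proof.
  intros Hf Hg. apply (is_derive_mult f g); try easy. intros; apply Rmult_comm.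
Qed.

Lemma is_derive_Rcomp (f g : R -> R) (x f' g' : R) :
  is_derive f (g x) f' -> is_derive g x g' ->
  is_derive (fun y : R => f (g y)) x (f' * g').
Proof. rewrite Rmult_comm. apply (is_derive_comp f g). Qed.

Lemma derive_zero_const (f : R -> R) (x y : R) :
  (forall z, is_derive f z 0) -> f x = f y.
Proof.
  intros Hf.
  destruct (Rtotal_order x y) as [H | [-> | H]]; trivial;
    destruct (mvt f (fun _ => 0) _ _ H (fun z _ => Hf z)) as [z [_ Hz]]; lra.
Qed.

(** Derivatives are given by witness functions instead of [Derive_n], so the closure rules below go
    by induction on [k] with the explicit formula for the derivative as witness. *)
Fixpoint differentiable_n (k : nat) (f : R -> R) : Prop :=
  match k with
  | O => True
  | S k => exists g, (forall x, is_derive f x (g x)) /\ differentiable_n k g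
  end.

(** Needed because the derivative of a product, an exponential or an inverse contains the function
    itself, which then has to be used at the lower order. *)
Lemma differentiable_n_S (k : nat) : forall f,
  differentiable_n (S k) f -> differentiable_n k f.
Proof.
  induction k as [|k IH]; intros f; simpl; [easy|].
  intros [g [Hg H]]. exists g. split; [easy | now apply IH].
Qed.

Lemma differentiable_n_const (k : nat) : forall a : R,
  differentiable_n k (fun _ => a).
Proof.
  induction k as [|k IH]; intros a; simpl; [easy|].
  exists (fun _ => 0). split; [|apply IH].
  intros x. apply (is_derive_const a).
Qed.

Lemma differentiable_n_plus (k : nat) : forall f g,
  differentiable_n k f -> differentiable_n k g ->
  differentiable_n k (fun x => f x + g x).
Proof.
  induction k as [|k IH]; intros f g; simpl; [easy|].
  intros [f' [Hf' Hf]] [g' [Hg' Hg]].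
  exists (fun x => f' x + g' x). split; [|now apply IH].
  intros x. now apply is_derive_Rplus.
Qed.

Lemma differentiable_n_opp (k : nat) : forall f,
  differentiable_n k f -> differentiable_n k (fun x => - f x).
Proof.
  induction k as [|k IH]; intros f; simpl; [easy|].
  intros [f' [Hf' Hf]]. exists (fun x => - f' x). split; [|now apply IH].
  intros x. now apply (is_derive_opp f).
Qed.

Lemma differentiable_n_mult (k : nat) : forall f g,
  differentiable_n k f -> differentiable_n k g ->
  differentiable_n k (fun x => f x * g x).
Proof.
  induction k as [|k IH]; intros f g; [easy|].
  intros Hf Hg.
  assert (Hf0 := differentiable_n_S _ _ Hf).
  assert (Hg0 := differentiable_n_S _ _ Hg).
  destruct Hf as [f' [Hf' Hf]]. destruct Hg as [g' [Hg' Hg]].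
  exists (fun x => f' x * g x + f x * g' x). split.
  - intros x. now apply is_derive_Rmult.
  - apply differentiable_n_plus; now apply IH.
Qed.

Lemma differentiable_n_exp (k : nat) : forall f,
  differentiable_n k f -> differentiable_n k (fun x => exp (f x)).
Proof.
  induction k as [|k IH]; intros f; [easy|].
  intros Hf. assert (Hf0 := differentiable_n_S _ _ Hf).
  destruct Hf as [f' [Hf' Hf]].
  exists (fun x => exp (f x) * f' x). split.
  - intros x. apply is_derive_Rcomp; [apply is_derive_exp | apply Hf'].
  - apply differentiable_n_mult; [now apply IH | easy].
Qed.

Lemma differentiable_n_inv (k : nat) : forall f,
  (forall x, f x <> 0) -> differentiable_n k f ->
  differentiable_n k (fun x => / f x).
Proof.
  induction k as [|k IH]; intros f Hnz; [easy|].
  intros Hf. assert (Hf0 := differentiable_n_S _ _ Hf).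
  destruct Hf as [f' [Hf' Hf]].
  exists (fun x => -1 * (f' x * (/ f x * / f x))). split.
  - intros x. eapply is_derive_eq.
    + apply (is_derive_inv f); [apply Hf' | apply Hnz].
    + field. apply Hnz.
  - repeat apply differentiable_n_mult; try easy;
      [apply differentiable_n_const | now apply IH | now apply IH].
Qed.

(** The order [k + j] is spent on [k] derivatives and leaves [j]; this links the witness form to
    [Derive_n]. *)
Lemma differentiable_n_Derive_n (k : nat) : forall j f,
  differentiable_n (k + j) f ->
  exists g, (forall x, Derive_n f k x = g x) /\ differentiable_n j g.
Proof.
  induction k as [|k IH]; intros j f Hf.
  - now exists f.
  - destruct (IH (S j) f) as [g [Hg [g' [Hg' Hj]]]].
    + now rewrite Nat.add_succ_r.
    + exists g'. split; [|easy]. intros x. simpl.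
      rewrite (Derive_ext _ g); [|easy]. now apply is_derive_unique.
Qed.

Lemma differentiable_n_smooth (f : R -> R) :
  (forall k, differentiable_n k f) -> smooth f.
Proof.
  intros Hf [|k] x; [easy|].
  destruct (differentiable_n_Derive_n k 1 f (Hf _)) as [g [Hg [g' [Hg' _]]]].
  simpl. apply (ex_derive_ext g); [easy|]. now exists (g' x).
Qed.

(** * The potential and the energy *)

(** Integrating the momentum equation gives [phi = c u - u^2 / 2 - s ln n]; this is its right side
    with [u = c (1 - 1/n)]. *)
Definition potential (c s n : R) : R := c ^ 2 / 2 * (1 - / n ^ 2) - s * ln n.

Definition dpotential (c s n : R) : R := (c ^ 2 - s * n ^ 2) / n ^ 3.

(** The antiderivative of [denergy] that vanishes at [1]: [H' exp H] integrates to [exp H - 1], and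
    [n H' = c^2 / n^2 - s] integrates to [c^2 (1 - 1/n) - s (n - 1)]. *)
Definition energy (c s n : R) : R :=
  exp (potential c s n) - 1 - c ^ 2 * (1 - / n) + s * (n - 1).

Definition denergy (c s n : R) : R :=
  dpotential c s n * (exp (potential c s n) - n).

Lemma is_derive_potential (c s n : R) :
  0 < n -> is_derive (potential c s) n (dpotential c s n).
Proof.
  intros Hn. unfold potential, dpotential. auto_derive.
  - repeat split; try easy. intros E. nra.
  - field. lra.
Qed.

Lemma is_derive_energy (c s n : R) :
  0 < n -> is_derive (energy c s) n (denergy c s n).
Proof.
  intros Hn.
  assert (H1 := is_derive_potential c s n Hn).
  assert (H2 : is_derive (fun x => exp (potential c s x)) n
                 (exp (potential c s n) * dpotential c s n)).
  { apply is_derive_Rcomp; [apply is_derive_exp | easy]. }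
  assert (H3 : is_derive (fun x => - 1 - c ^ 2 * (1 - / x) + s * (x - 1)) n
                 (- c ^ 2 / n ^ 2 + s)).
  { auto_derive; [lra | field; lra]. }
  assert (H4 := is_derive_Rplus _ _ _ _ _ H2 H3).
  eapply is_derive_eq.
  - eapply is_derive_ext; [|exact H4]. intros x. unfold energy. simpl. ring.
  - unfold denergy, dpotential. field. lra.
Qed.

Lemma potential_1 (c s : R) : potential c s 1 = 0.
Proof. unfold potential. rewrite ln_1. field. Qed.

Lemma energy_1 (c s : R) : energy c s 1 = 0.
Proof. unfold energy. rewrite potential_1, exp_0. field. Qed.

Lemma dpotential_pos (c s n : R) :
  0 < n -> s * n ^ 2 < c ^ 2 -> 0 < dpotential c s n.
Proof.
  intros Hn H. unfold dpotential. apply Rdiv_lt_0_compat; [lra|].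
  now apply pow_lt.
Qed.

(** The sign of [potential - ln] is the sign of [exp H - n], hence of [denergy] wherever
    [dpotential] is positive. The derivative shows a single turning point, at
    [n^2 = c^2 / (1 + s)]. *)
Lemma is_derive_potential_sub_ln (c s n : R) : 0 < n ->
  is_derive (fun x => potential c s x - ln x) n
    ((c ^ 2 - (1 + s) * n ^ 2) / n ^ 3).
Proof.
  intros Hn. unfold potential. auto_derive.
  - repeat split; try easy. intros E. nra.
  - field. lra.
Qed.

Lemma exp_potential_gt (c s n : R) :
  0 < n -> 0 < potential c s n - ln n -> n < exp (potential c s n).
Proof.
  intros Hn H. rewrite <- (exp_ln n) at 1 by easy. apply exp_increasing. lra.
Qed.

Lemma exp_potential_lt (c s n : R) :
  0 < n -> potential c s n - ln n < 0 -> exp (potential c s n) < n.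
Proof.
  intros Hn H. rewrite <- (exp_ln n) at 2 by easy. apply exp_increasing. lra.
Qed.

Lemma potential_sub_ln_increasing (c s a b : R) :
  0 <= s -> 0 < a < b -> (1 + s) * b ^ 2 <= c ^ 2 ->
  potential c s a - ln a < potential c s b - ln b.
Proof.
  intros Hs Hab Hb.
  destruct (mvt (fun x => potential c s x - ln x)
              (fun n => (c ^ 2 - (1 + s) * n ^ 2) / n ^ 3) a b) as [x [Hx E]].
  - easy.
  - intros x Hx. apply is_derive_potential_sub_ln. lra.
  - assert (0 < (c ^ 2 - (1 + s) * x ^ 2) / x ^ 3).
    { apply Rdiv_lt_0_compat; [|apply pow_lt; lra].
      assert (x ^ 2 < b ^ 2) by nra. nra. }
    assert (0 < (c ^ 2 - (1 + s) * x ^ 2) / x ^ 3 * (b - a))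
      by (apply Rmult_lt_0_compat; lra). lra.
Qed.

Lemma potential_sub_ln_decreasing (c s a b : R) :
  0 <= s -> 0 < a < b -> c ^ 2 <= (1 + s) * a ^ 2 ->
  potential c s b - ln b < potential c s a - ln a.
Proof.
  intros Hs Hab Hb.
  destruct (mvt (fun x => potential c s x - ln x)
              (fun n => (c ^ 2 - (1 + s) * n ^ 2) / n ^ 3) a b) as [x [Hx E]].
  - easy.
  - intros x Hx. apply is_derive_potential_sub_ln. lra.
  - assert (0 < ((1 + s) * x ^ 2 - c ^ 2) / x ^ 3).
    { apply Rdiv_lt_0_compat; [|apply pow_lt; lra].
      assert (a ^ 2 < x ^ 2) by nra. nra. }
    assert (0 < ((1 + s) * x ^ 2 - c ^ 2) / x ^ 3 * (b - a))
      by (apply Rmult_lt_0_compat; lra).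
    replace ((c ^ 2 - (1 + s) * x ^ 2) / x ^ 3)
      with (- (((1 + s) * x ^ 2 - c ^ 2) / x ^ 3)) in E by (field; lra). lra.
Qed.

Lemma energy_increment (c s a b : R) :
  0 < a < b -> exists x, a < x < b /\
  energy c s b - energy c s a = denergy c s x * (b - a).
Proof.
  intros Hab. apply mvt; [easy|]. intros x Hx. apply is_derive_energy. lra.
Qed.

(** On [(0, 1)] the function [potential - ln] increases to its value [0] at [1], so it is negative
    there; hence [exp H < n] and the energy strictly decreases to [energy c s 1 = 0]. *)
Lemma energy_pos_left (c s n : R) :
  0 <= s -> 1 + s < c ^ 2 -> 0 < n < 1 -> 0 < energy c s n.
Proof.
  intros Hs Hc Hn.
  destruct (energy_increment c s n 1) as [x [Hx E]]; [easy|].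
  rewrite energy_1 in E.
  assert (x ^ 2 <= 1) by nra.
  assert (0 < dpotential c s x) by (apply dpotential_pos; nra).
  assert (K : potential c s x - ln x < potential c s 1 - ln 1).
  { apply potential_sub_ln_increasing; nra. }
  rewrite potential_1, ln_1 in K.
  assert (exp (potential c s x) < x) by (apply exp_potential_lt; lra).
  unfold denergy in E.
  assert (0 < dpotential c s x * (x - exp (potential c s x)) * (1 - n)).
  { apply Rmult_lt_0_compat; [apply Rmult_lt_0_compat|]; lra. }
  lra.
Qed.

(** * The first zero of the energy *)

(** Here [m] is the height of the wave. [peak_subsonic] keeps [dpotential] positive on all of
    [(0, m]]; together with [peak_exp] it gives [denergy c s m < 0], so the zero at [m] is
    simple. *)
Record is_peak (c s m : R) : Prop := {
  peak_gt1 : 1 < m;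
  peak_subsonic : s * m ^ 2 < c ^ 2;
  peak_energy : energy c s m = 0;
  peak_exp : exp (potential c s m) < m;
  peak_pos : forall n, 1 < n < m -> 0 < energy c s n
}.

(** The energy rises from [0] at [1] as long as [potential - ln] is nonnegative and falls once it is
    negative. Since it is negative at [b], it has a zero in between, which lies on the falling
    branch. The bound on [b] is not strict, so that [b] may be the sonic point. *)
Lemma peak_exists (c s b : R) :
  0 < c -> 0 <= s -> 1 + s < c ^ 2 -> 1 < b -> s * b ^ 2 <= c ^ 2 ->
  energy c s b < 0 -> exists m, is_peak c s m.
Proof.
  intros Hc0 Hs Hc Hb Hsb Hneg.
  (* [potential - ln] increases up to [a] and decreases after it *)
  set (a := sqrt (c ^ 2 / (1 + s))).
  assert (Ha2 : (1 + s) * a ^ 2 = c ^ 2).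
  { unfold a. rewrite pow2_sqrt; [field; lra|].
    apply Rlt_le, Rdiv_lt_0_compat; lra. }
  assert (Ha0 : 0 <= a) by apply sqrt_pos.
  clearbody a.
  assert (Ha1 : 1 < a).
  { apply Rnot_le_lt. intros H. assert (a ^ 2 <= 1) by nra. nra. }
  assert (Hlow : forall n, 1 < n <= a -> 0 < energy c s n).
  { intros n Hn.
    destruct (energy_increment c s 1 n) as [x [Hx E]]; [lra|].
    rewrite energy_1 in E.
    assert (x ^ 2 < a ^ 2) by nra.
    assert (s * x ^ 2 <= s * a ^ 2) by (apply Rmult_le_compat_l; lra).
    assert (0 < dpotential c s x) by (apply dpotential_pos; nra).
    assert (K : potential c s 1 - ln 1 < potential c s x - ln x).
    { apply potential_sub_ln_increasing; nra. }
    rewrite potential_1, ln_1 in K.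
    assert (x < exp (potential c s x)) by (apply exp_potential_gt; lra).
    unfold denergy in E.
    assert (0 < dpotential c s x * (exp (potential c s x) - x) * (n - 1)).
    { apply Rmult_lt_0_compat; [apply Rmult_lt_0_compat|]; lra. }
    lra. }
  assert (Hab : a < b).
  { destruct (Rlt_le_dec a b) as [H|H]; [easy|].
    assert (0 < energy c s b) by (apply Hlow; lra). lra. }
  (* Since [potential - ln] decreases after [a], its nonnegativity at [n] makes it positive on
     [[a, n)], and the energy increases from [energy c s a] up to [n]. *)
  assert (Hup : forall n, a <= n <= b -> 0 <= potential c s n - ln n ->
                  0 < energy c s n).
  { intros n Hn HK. assert (Ea : 0 < energy c s a) by (apply Hlow; lra).
    destruct (Req_dec a n) as [<-|Hne]; [easy|].
    destruct (energy_increment c s a n) as [x [Hx E]]; [lra|].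
    assert (0 < dpotential c s x).
    { apply dpotential_pos; [lra|].
      assert (x ^ 2 < b ^ 2) by nra.
      destruct (Req_dec s 0) as [->|]; nra. }
    assert (K : potential c s n - ln n < potential c s x - ln x).
    { apply potential_sub_ln_decreasing; [lra | lra |].
      assert (a ^ 2 <= x ^ 2) by nra. nra. }
    assert (x < exp (potential c s x)) by (apply exp_potential_gt; lra).
    unfold denergy in E.
    assert (0 < dpotential c s x * (exp (potential c s x) - x) * (n - a)).
    { apply Rmult_lt_0_compat; [apply Rmult_lt_0_compat|]; lra. }
    lra. }
  destruct (IVT_interv (fun x => - energy c s x) a b) as [m [Hm Em]].
  - intros x Hx. apply continuity_pt_opp.
    apply (is_derive_continuity_pt _ _ (denergy c s x)), is_derive_energy. lra.
  - easy.
  - assert (0 < energy c s a) by (apply Hlow; lra). lra.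
  - lra.
  - assert (Hmb : m < b).
    { destruct (Req_dec m b) as [->|]; lra. }
    assert (Kneg : forall n, a <= n <= b -> energy c s n <= 0 ->
                     potential c s n - ln n < 0).
    { intros n Hn Hn0. apply Rnot_le_lt. intros K.
      specialize (Hup n Hn K). lra. }
    exists m. constructor.
    + lra.
    + destruct (Req_dec s 0) as [->|]; [nra|].
      assert (m ^ 2 < b ^ 2) by nra. nra.
    + lra.
    + apply exp_potential_lt; [lra|]. apply Kneg; lra.
    (* Past [a], either [Hup] applies at [n], or [potential - ln] is negative on all of [[n, m]] and
       the energy strictly decreases to [0] at [m]. *)
    + intros n Hn. destruct (Rle_lt_dec n a) as [H|H]; [apply Hlow; lra|].
      destruct (Rle_lt_dec 0 (potential c s n - ln n)) as [HK|HK];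
        [apply Hup; lra|].
      destruct (energy_increment c s n m) as [x [Hx E]]; [lra|].
      assert (0 < dpotential c s x).
      { apply dpotential_pos; [lra|]. assert (x ^ 2 < b ^ 2) by nra. nra. }
      assert (potential c s x - ln x < potential c s n - ln n).
      { apply potential_sub_ln_decreasing; [lra | lra |].
        assert (a ^ 2 <= n ^ 2) by nra. nra. }
      assert (exp (potential c s x) < x) by (apply exp_potential_lt; lra).
      unfold denergy in E.
      assert (0 < dpotential c s x * (x - exp (potential c s x)) * (m - n)).
      { apply Rmult_lt_0_compat; [apply Rmult_lt_0_compat|]; lra. }
      lra.
Qed.

(** * From the speed condition to the peak *)

(** The difference of logarithms [ln (1 + z^2) - z^2 / 2] vanishes at [0] and increases on [[0, 1]],
    so it is positive at [1]. Were it nonpositive at [c], the intermediate value theorem would give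
    a root of [zeta0_eq] in [[1, c]], below [zeta], against uniqueness of the root. *)
Lemma speed_zeta0 (c zeta : R) :
  is_zeta0 zeta -> 1 < c < zeta -> exp (c ^ 2 / 2) < c ^ 2 + 1.
Proof.
  intros [_ [_ Hz]] Hc.
  assert (D : forall x, is_derive (fun z => ln (1 + z ^ 2) - z ^ 2 / 2) x
                (x * (1 - x ^ 2) / (1 + x ^ 2))).
  { intros x. auto_derive; [nra | field; nra]. }
  assert (H1 : 0 < ln (1 + 1 ^ 2) - 1 ^ 2 / 2).
  { destruct (mvt _ _ 0 1 Rlt_0_1 (fun x _ => D x)) as [x [Hx E]].
    replace (1 + 0 ^ 2) with 1 in E by ring. rewrite ln_1 in E.
    assert (0 < x * (1 - x ^ 2) / (1 + x ^ 2)).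
    { apply Rdiv_lt_0_compat; [apply Rmult_lt_0_compat|]; nra. }
    lra. }
  destruct (Rlt_le_dec 0 (ln (1 + c ^ 2) - c ^ 2 / 2)) as [H|H].
  - rewrite <- (exp_ln (c ^ 2 + 1)) by nra.
    apply exp_increasing. rewrite Rplus_comm. lra.
  - exfalso.
    assert (exists w, 1 <= w <= c /\ ln (1 + w ^ 2) - w ^ 2 / 2 = 0)
      as [w [Hw E]].
    { destruct H as [H|H]; [|exists c; split; [lra|exact H]].
      destruct (IVT_interv (fun z => - (ln (1 + z ^ 2) - z ^ 2 / 2)) 1 c)
        as [w [Hw E]]; try lra.
      - intros x _. apply continuity_pt_opp.
        eapply is_derive_continuity_pt, D.
      - exists w. split; lra. }
    assert (w = zeta); [|lra].
    apply Hz; [lra|]. unfold zeta0_eq.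
    rewrite Rplus_comm, <- (exp_ln (1 + w ^ 2)) by nra. f_equal. lra.
Qed.

(** Multiplied by [z^s], this is the strict comparison of the two sides of [zeta_eq]; with [z] the
    sonic point it says that the energy is negative there. The proof follows the case [s = 0],
    starting from [z0 = sqrt ((1 + s) / s)]. *)
Lemma speed_zeta_sigma (s zeta z : R) :
  0 < s -> is_zeta_sigma s zeta -> 1 + s < s * z ^ 2 -> 1 < z < zeta ->
  exp (s / 2 * (z ^ 2 - 1) - s * ln z) < s * (z - 1) ^ 2 + 1.
Proof.
  intros Hs [_ [_ Hzeta]] Hz2 Hz.
  set (L := fun z => s * ln z + ln (s * (z - 1) ^ 2 + 1) - s / 2 * (z ^ 2 - 1)).
  assert (P : forall x, 0 < s * (x - 1) ^ 2 + 1).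
  { intros x. assert (0 <= s * (x - 1) ^ 2).
    { apply Rmult_le_pos; [lra | apply pow2_ge_0]. }
    lra. }
  assert (D : forall x, 1 <= x -> is_derive L x
    (s * (x - 1) ^ 2 * (1 + s - s * x ^ 2) / (x * (s * (x - 1) ^ 2 + 1)))).
  { intros x Hx. unfold L. specialize (P x). auto_derive.
    - split; [lra|]. split; [|easy]. simpl in P. lra.
    - field. simpl in P |- *. split; lra. }
  set (z0 := sqrt ((1 + s) / s)).
  assert (Hz0 : s * z0 ^ 2 = 1 + s).
  { unfold z0. rewrite pow2_sqrt; [field; lra|].
    apply Rlt_le, Rdiv_lt_0_compat; lra. }
  assert (Hz00 : 0 <= z0) by apply sqrt_pos. clearbody z0.
  assert (Hz01 : 1 < z0).
  { apply Rnot_le_lt. intros H. assert (z0 ^ 2 <= 1) by nra. nra. }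
  assert (Hz0z : z0 < z).
  { apply Rnot_le_lt. intros H. assert (z ^ 2 <= z0 ^ 2) by nra. nra. }
  assert (H1 : 0 < L z0).
  { assert (L 1 = 0) as L1.
    { unfold L. replace (s * (1 - 1) ^ 2 + 1) with 1 by ring.
      rewrite ln_1. ring. }
    destruct (mvt L _ 1 z0 Hz01 (fun x Hx => D x (proj1 Hx))) as [x [Hx E]].
    specialize (P x).
    match type of E with _ = ?d * _ => assert (0 < d) end.
    { assert (x ^ 2 < z0 ^ 2) by nra.
      apply Rdiv_lt_0_compat; [|apply Rmult_lt_0_compat; lra].
      apply Rmult_lt_0_compat; [|nra].
      apply Rmult_lt_0_compat; [lra|]. apply pow_lt. lra. }
    assert (0 < L z0 - L 1); [|lra]. rewrite E.
    apply Rmult_lt_0_compat; lra. }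
  destruct (Rlt_le_dec 0 (L z)) as [H|H].
  - rewrite <- (exp_ln (s * (z - 1) ^ 2 + 1)) by apply P.
    apply exp_increasing. unfold L in H. lra.
  - exfalso.
    assert (exists w, z0 <= w <= z /\ L w = 0) as [w [Hw E]].
    { destruct H as [H|H]; [|exists z; split; [lra|exact H]].
      destruct (IVT_interv (fun z => - L z) z0 z) as [w [Hw E]]; try lra.
      - intros x Hx. apply continuity_pt_opp.
        eapply is_derive_continuity_pt, D. lra.
      - exists w. split; lra. }
    assert (w = zeta); [|lra].
    apply Hzeta; [lra|]. unfold zeta_eq, Rpower.
    rewrite <- (exp_ln (s * (w - 1) ^ 2 + 1)) by apply P.
    rewrite <- exp_plus. f_equal. unfold L in E. lra.
Qed.

Lemma speed_condition_peak (c s : R) :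
  0 < c -> 0 <= s -> speed_condition s c ->
  1 + s < c ^ 2 /\ exists m, is_peak c s m.
Proof.
  intros Hc Hs [Hpos Hzero].
  destruct Hs as [Hs | <-].
  - destruct (Hpos Hs) as [zeta [Hz [H1 H2]]]. clear Hpos Hzero.
    assert (Hq : 0 < sqrt s) by now apply sqrt_lt_R0.
    (* The sonic point, where [s b^2 = c^2] and [dpotential] vanishes. *)
    set (b := c / sqrt s) in *.
    assert (Hb : s * b ^ 2 = c ^ 2).
    { unfold b. rewrite <- (pow2_sqrt s) at 1 by lra. field. lra. }
    set (z0 := sqrt ((1 + s) / s)) in *.
    assert (Hz0 : s * z0 ^ 2 = 1 + s).
    { unfold z0. rewrite pow2_sqrt; [field; lra|].
      apply Rlt_le, Rdiv_lt_0_compat; lra. }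
    assert (Hz00 : 0 <= z0) by apply sqrt_pos. clearbody z0.
    assert (Hz01 : 1 < z0).
    { apply Rnot_le_lt. intros H. assert (z0 ^ 2 <= 1) by nra. nra. }
    assert (Hc2 : 1 + s < c ^ 2).
    { assert (z0 ^ 2 < b ^ 2) by nra. nra. }
    split; [easy|]. apply (peak_exists c s b); try lra.
    assert (E := speed_zeta_sigma s zeta b Hs Hz).
    assert (Hp : potential c s b = s / 2 * (b ^ 2 - 1) - s * ln b).
    { unfold potential. rewrite <- Hb. field. lra. }
    unfold energy. rewrite Hp, <- Hb.
    (* With [c^2 = s b^2] the energy at [b] becomes [exp H - (s (b - 1)^2 + 1)]. *)
    replace (s * b ^ 2 * (1 - / b)) with (s * b ^ 2 - s * b) by (field; lra).
    lra.
  - destruct (Hzero eq_refl) as [zeta [Hz Hc1]]. clear Hpos Hzero.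
    assert (E := speed_zeta0 c zeta Hz Hc1).
    split; [nra|].
    (* For [s = 0] the energy tends to [- d] at infinity. At finite [b] it is below [- d + c^2 / b],
       so [b = 1 + c^2 / d] is large enough. *)
    set (d := c ^ 2 + 1 - exp (c ^ 2 / 2)).
    assert (Hd : 0 < d) by (unfold d; lra).
    assert (Hcd : 0 < c ^ 2 / d) by (apply Rdiv_lt_0_compat; nra).
    apply (peak_exists c 0 (1 + c ^ 2 / d)); try nra.
    set (b := 1 + c ^ 2 / d) in *.
    assert (Hcb : c ^ 2 * / b < d).
    { apply (Rmult_lt_reg_r b); [unfold b; lra|].
      replace (c ^ 2 * / b * b) with (c ^ 2) by (field; unfold b; lra).
      unfold b. replace (d * (1 + c ^ 2 / d)) with (d + c ^ 2) by (field; lra).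
      lra. }
    assert (Hp : potential c 0 b < c ^ 2 / 2).
    { unfold potential.
      assert (0 < c ^ 2 * / b ^ 2).
      { apply Rdiv_lt_0_compat; apply pow_lt; unfold b; lra. }
      lra. }
    apply exp_increasing in Hp. unfold energy. unfold d in Hcb. lra.
Qed.

(** * Gronwall's inequality, interior maxima and uniqueness for the profile equation *)

Lemma is_derive_continuous (f : R -> R) (x l : R) :
  is_derive f x l -> continuous f x.
Proof. intros H. apply (ex_derive_continuous f x). now exists l. Qed.

Lemma derive_zero_lim (f : R -> R) (l : R) :
  (forall x, is_derive f x 0) -> is_lim f p_infty l -> forall x, f x = l.
Proof.
  intros Hf Hl x.
  assert (H : is_lim (fun _ => f x) p_infty l).
  { apply (is_lim_ext f); [|easy]. intros y. now apply derive_zero_const. }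
  apply is_lim_unique in H. rewrite Lim_const in H. now injection H.
Qed.

(** [E exp (- K x)] is nonincreasing and [E exp (K x)] is nondecreasing. The first carries the zero
    from [x0] to the right, the second to the left. *)
Lemma gronwall_zero (E E' : R -> R) (K x0 : R) :
  (forall x, is_derive E x (E' x)) -> (forall x, 0 <= E x) ->
  (forall x, Rabs (E' x) <= K * E x) -> E x0 = 0 -> forall x, E x = 0.
Proof.
  intros HE Hpos HK H0 x.
  assert (D : forall k y, is_derive (fun z => E z * exp (k * z)) y
                ((E' y + k * E y) * exp (k * y))).
  { intros k y. eapply is_derive_eq.
    - apply (is_derive_Rmult E (fun z => exp (k * z)) y (E' y) (k * exp (k * y)));
        [apply HE | auto_derive; [easy | ring]].
    - ring. }
  specialize (Hpos x).
  destruct (Rtotal_order x0 x) as [H | [<- | H]]; [|easy|].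
  - destruct (mvt _ _ _ _ H (fun y _ => D (- K) y)) as [y [_ Ey]].
    specialize (HK y). apply Rabs_le_between in HK.
    assert (0 < exp (- K * y)) by apply exp_pos.
    assert (0 < exp (- K * x)) by apply exp_pos.
    rewrite H0 in Ey.
    assert (0 <= - (E' y + - K * E y) * exp (- K * y) * (x - x0)).
    { repeat apply Rmult_le_pos; lra. }
    assert (E x * exp (- K * x) <= 0) by lra. nra.
  - destruct (mvt _ _ _ _ H (fun y _ => D K y)) as [y [_ Ey]].
    specialize (HK y). apply Rabs_le_between in HK.
    assert (0 < exp (K * y)) by apply exp_pos.
    assert (0 < exp (K * x)) by apply exp_pos.
    rewrite H0 in Ey.
    assert (0 <= (E' y + K * E y) * exp (K * y) * (x0 - x)).
    { repeat apply Rmult_le_pos; lra. }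
    assert (E x * exp (K * x) <= 0) by lra. nra.
Qed.

(** Outside a compact interval [f] stays below [f x0], so its maximum over a slightly larger
    interval is a global one. *)
Lemma max_attained (f f' : R -> R) (l x0 : R) :
  (forall x, is_derive f x (f' x)) ->
  is_lim f p_infty l -> is_lim f m_infty l -> l < f x0 ->
  exists x1, (forall x, f x <= f x1) /\ f' x1 = 0.
Proof.
  intros Hf Hp Hm Hx0.
  assert (He : 0 < f x0 - l) by lra.
  apply is_lim_spec in Hp. apply is_lim_spec in Hm.
  destruct (Hp (mkposreal _ He)) as [B HB].
  destruct (Hm (mkposreal _ He)) as [A HA]. simpl in HA, HB.
  set (a := Rmin A x0 - 1). set (b := Rmax B x0 + 1).
  assert (Ha : a < A /\ a < x0).
  { unfold a. pose proof (Rmin_l A x0). pose proof (Rmin_r A x0). lra. }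
  assert (Hb : B < b /\ x0 < b).
  { unfold b. pose proof (Rmax_l B x0). pose proof (Rmax_r B x0). lra. }
  clearbody a b.
  destruct (continuity_ab_maj f a b) as [x1 [Hmax Hx1]]; [lra| |].
  { intros x _. eapply is_derive_continuity_pt, Hf. }
  assert (Hglob : forall x, f x <= f x1).
  { intros x. assert (f x0 <= f x1) by (apply Hmax; lra).
    destruct (Rlt_le_dec x a) as [H1|H1].
    - assert (K : Rabs (f x - l) < f x0 - l) by (apply HA; lra).
      apply Rabs_lt_between in K. lra.
    - destruct (Rlt_le_dec b x) as [H2|H2].
      + assert (K : Rabs (f x - l) < f x0 - l) by (apply HB; lra).
        apply Rabs_lt_between in K. lra.
      + apply Hmax. lra. }
  exists x1. split; [easy|].
  assert (pr : derivable_pt f x1) by (exists (f' x1); apply is_derive_Reals, Hf).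
  rewrite <- (deriv_maximum f (x1 - 1) (x1 + 1) x1 pr); try lra.
  - symmetry. apply derive_pt_eq. apply is_derive_Reals, Hf.
  - intros x _ _. apply Hglob.
Qed.

Lemma smooth_is_derive (f : R -> R) :
  smooth f -> forall x, is_derive f x (Derive f x).
Proof. intros Hf x. apply Derive_correct, (Hf 1%nat x). Qed.

Lemma smooth_is_derive2 (f : R -> R) :
  smooth f -> forall x, is_derive (Derive f) x (Derive_n f 2 x).
Proof. intros Hf x. apply Derive_correct, (Hf 2%nat x). Qed.

Lemma exp_lipschitz (M a b : R) :
  a <= M -> b <= M -> Rabs (exp a - exp b) <= exp M * Rabs (a - b).
Proof.
  assert (K : forall a b, a < b -> b <= M ->
    Rabs (exp a - exp b) <= exp M * Rabs (a - b)).
  { clear. intros a b Hab Hb.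
    destruct (mvt exp exp a b Hab) as [x [Hx E]].
    { intros x _. apply is_derive_exp. }
    assert (exp x < exp M) by (apply exp_increasing; lra).
    assert (0 < exp x) by apply exp_pos.
    rewrite (Rabs_minus_sym a), (Rabs_minus_sym (exp a)), E, Rabs_mult,
      (Rabs_pos_eq (exp x)) by lra.
    apply Rmult_le_compat_r; [apply Rabs_pos | lra]. }
  intros Ha Hb. destruct (Rtotal_order a b) as [H | [-> | H]].
  - now apply K.
  - replace (exp b - exp b) with 0 by ring. replace (b - b) with 0 by ring.
    rewrite Rabs_R0. lra.
  - rewrite Rabs_minus_sym, (Rabs_minus_sym a). now apply K.
Qed.

(** On [[1, m]] the numerator is smallest and the denominator largest at [m]. *)
Lemma dpotential_lower (c s m n : R) :
  0 <= s -> s * m ^ 2 < c ^ 2 -> 1 <= n <= m ->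
  (c ^ 2 - s * m ^ 2) / m ^ 3 <= dpotential c s n.
Proof.
  intros Hs Hm Hn. unfold dpotential.
  assert (n ^ 2 <= m ^ 2) by (apply pow_incr; lra).
  assert (n ^ 3 <= m ^ 3) by (apply pow_incr; lra).
  assert (0 < n ^ 3) by (apply pow_lt; lra).
  apply Rmult_le_compat; [nra | | nra |].
  - apply Rlt_le, Rinv_0_lt_compat. lra.
  - now apply Rinv_le_contravar.
Qed.

(** The inverse of [potential] is Lipschitz on the range of a wave, which makes [n] a Lipschitz
    function of [phi]. *)
Lemma potential_expanding (c s m : R) :
  0 <= s -> s * m ^ 2 < c ^ 2 -> 1 < m ->
  exists h, 0 < h /\ forall a b, 1 <= a <= m -> 1 <= b <= m ->
    h * Rabs (a - b) <= Rabs (potential c s a - potential c s b).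
Proof.
  intros Hs Hm H1. exists ((c ^ 2 - s * m ^ 2) / m ^ 3).
  split; [now apply dpotential_pos; [lra|] |].
  assert (K : forall a b, 1 <= a <= m -> 1 <= b <= m -> a < b ->
    (c ^ 2 - s * m ^ 2) / m ^ 3 * Rabs (a - b) <=
    Rabs (potential c s a - potential c s b)).
  { intros a b Ha Hb Hab.
    destruct (mvt (potential c s) (dpotential c s) a b Hab) as [x [Hx E]].
    { intros x Hx. apply is_derive_potential. lra. }
    rewrite (Rabs_minus_sym a), (Rabs_minus_sym (potential c s a)), E, Rabs_mult.
    apply Rmult_le_compat_r; [apply Rabs_pos|].
    eapply Rle_trans; [|apply Rle_abs].
    apply dpotential_lower; lra. }
  intros a b Ha Hb. destruct (Rtotal_order a b) as [H | [-> | H]].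
  - now apply K.
  - replace (b - b) with 0 by ring.
    rewrite Rabs_R0, Rmult_0_r. apply Rabs_pos.
  - rewrite Rabs_minus_sym, (Rabs_minus_sym (potential c s a)). now apply K.
Qed.

Lemma potential_incr (c s m a b : R) :
  0 <= s -> s * m ^ 2 < c ^ 2 -> 1 <= a -> a < b -> b <= m ->
  potential c s a < potential c s b.
Proof.
  intros Hs Hm Ha Hab Hb.
  destruct (mvt (potential c s) (dpotential c s) a b Hab) as [x [Hx E]].
  { intros x Hx. apply is_derive_potential. lra. }
  assert (0 < dpotential c s x).
  { apply dpotential_pos; [lra|]. assert (x ^ 2 <= m ^ 2) by nra. nra. }
  nra.
Qed.

(** On the range [[1, m]] the density is a Lipschitz function of [phi], so
    [phi'' = (exp phi - n) / eps] has a Lipschitz right side. Gronwall's inequality then applies to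
    the squared distance of the pairs [(phi, phi')]. *)
Lemma tw_ode_unique (c s eps m x0 : R) (n1 phi1 p1 n2 phi2 p2 : R -> R) :
  0 < eps -> 0 <= s -> s * m ^ 2 < c ^ 2 -> 1 < m ->
  (forall x, 1 <= n1 x <= m) -> (forall x, 1 <= n2 x <= m) ->
  (forall x, phi1 x = potential c s (n1 x)) ->
  (forall x, phi2 x = potential c s (n2 x)) ->
  (forall x, is_derive phi1 x (p1 x)) -> (forall x, is_derive phi2 x (p2 x)) ->
  (forall x, is_derive p1 x ((exp (phi1 x) - n1 x) / eps)) ->
  (forall x, is_derive p2 x ((exp (phi2 x) - n2 x) / eps)) ->
  n1 x0 = n2 x0 -> p1 x0 = p2 x0 -> forall x, n1 x = n2 x.
Proof.
  intros He Hs Hm H1 Hn1 Hn2 Hf1 Hf2 Dphi1 Dphi2 Dp1 Dp2 En Ep.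
  destruct (potential_expanding c s m Hs Hm H1) as [h [Hh Hexp]].
  set (M := potential c s m).
  (* [exp M] is a Lipschitz constant of [exp] below [M], and [/ h] one of the inverse of
     [potential]. *)
  set (L := (exp M + / h) / eps).
  assert (HM : forall n, 1 <= n <= m -> potential c s n <= M).
  { intros n [Hn [Hnm | ->]]; [|apply Rle_refl].
    apply Rlt_le, (potential_incr c s m); lra. }
  assert (Lip : forall x,
    Rabs ((exp (phi1 x) - n1 x) / eps - (exp (phi2 x) - n2 x) / eps) <=
    L * Rabs (phi1 x - phi2 x)).
  { intros x.
    replace ((exp (phi1 x) - n1 x) / eps - (exp (phi2 x) - n2 x) / eps)
      with (((exp (phi1 x) - exp (phi2 x)) - (n1 x - n2 x)) * / eps)
      by (field; lra).
    rewrite Rabs_mult, (Rabs_pos_eq (/ eps))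
      by (apply Rlt_le, Rinv_0_lt_compat, He).
    unfold L, Rdiv. rewrite Rmult_assoc, (Rmult_comm (/ eps)), <- Rmult_assoc.
    apply Rmult_le_compat_r; [apply Rlt_le, Rinv_0_lt_compat, He|].
    eapply Rle_trans; [apply Rabs_triang|]. rewrite Rabs_Ropp.
    assert (E1 : Rabs (exp (phi1 x) - exp (phi2 x)) <=
                 exp M * Rabs (phi1 x - phi2 x)).
    { apply exp_lipschitz; [rewrite Hf1 | rewrite Hf2]; now apply HM. }
    assert (E2 := Hexp _ _ (Hn1 x) (Hn2 x)).
    rewrite <- Hf1, <- Hf2 in E2.
    apply (Rmult_le_compat_l (/ h)) in E2;
      [|apply Rlt_le, Rinv_0_lt_compat, Hh].
    rewrite <- Rmult_assoc, Rinv_l, Rmult_1_l in E2 by lra. lra. }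
  assert (G : forall x, (phi1 x - phi2 x) ^ 2 + (p1 x - p2 x) ^ 2 = 0).
  { apply (gronwall_zero _ (fun x =>
      2 * (phi1 x - phi2 x) * (p1 x - p2 x) +
      2 * (p1 x - p2 x) *
        ((exp (phi1 x) - n1 x) / eps - (exp (phi2 x) - n2 x) / eps))
      (1 + L) x0).
    - intros x. auto_derive.
      + repeat split; eexists; first [apply Dphi1 | apply Dphi2 | apply Dp1 | apply Dp2].
      + change (Derive (fun x => phi1 x) x) with (Derive phi1 x).
        change (Derive (fun x => phi2 x) x) with (Derive phi2 x).
        change (Derive (fun x => p1 x) x) with (Derive p1 x).
        change (Derive (fun x => p2 x) x) with (Derive p2 x).
        rewrite (is_derive_unique _ _ _ (Dphi1 x)),
          (is_derive_unique _ _ _ (Dphi2 x)),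
          (is_derive_unique _ _ _ (Dp1 x)), (is_derive_unique _ _ _ (Dp2 x)).
        ring.
    - intros x. pose proof (pow2_ge_0 (phi1 x - phi2 x)).
      pose proof (pow2_ge_0 (p1 x - p2 x)). lra.
    - intros x. specialize (Lip x).
      set (F := (exp (phi1 x) - n1 x) / eps - (exp (phi2 x) - n2 x) / eps) in *.
      assert (0 < L).
      { apply Rdiv_lt_0_compat; [|easy].
        assert (0 < exp M) by apply exp_pos.
        assert (0 < / h) by now apply Rinv_0_lt_compat. lra. }
      rewrite <- (pow2_abs (phi1 x - phi2 x)), <- (pow2_abs (p1 x - p2 x)).
      eapply Rle_trans; [apply Rabs_triang|].
      rewrite !Rabs_mult, (Rabs_pos_eq 2) by lra.
      assert (0 <= Rabs (phi1 x - phi2 x)) by apply Rabs_pos.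
      assert (0 <= Rabs (p1 x - p2 x)) by apply Rabs_pos.
      set (a := Rabs (phi1 x - phi2 x)) in *.
      set (b := Rabs (p1 x - p2 x)) in *.
      assert (2 * b * Rabs F <= 2 * b * (L * a))
        by (apply Rmult_le_compat_l; lra).
      (* The derivative is at most [2 (1 + L) a b], hence at most [(1 + L) (a^2 + b^2)]. *)
      assert (0 <= (1 + L) * (a - b) ^ 2)
        by (apply Rmult_le_pos; [lra | apply pow2_ge_0]).
      lra.
    - rewrite Hf1, Hf2, En, Ep. ring. }
  intros x. specialize (G x).
  assert (E : potential c s (n1 x) - potential c s (n2 x) = 0).
  { rewrite <- Hf1, <- Hf2.
    pose proof (pow2_ge_0 (phi1 x - phi2 x)).
    pose proof (pow2_ge_0 (p1 x - p2 x)).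
    destruct (Req_dec (phi1 x - phi2 x) 0) as [|Hne]; [easy|].
    apply (pow_nonzero _ 2) in Hne. lra. }
  assert (K := Hexp _ _ (Hn1 x) (Hn2 x)). rewrite E, Rabs_R0 in K.
  assert (Rabs (n1 x - n2 x) = 0).
  { assert (0 <= Rabs (n1 x - n2 x)) by apply Rabs_pos. nra. }
  destruct (Req_dec (n1 x - n2 x) 0) as [|Hne]; [lra|].
  now apply Rabs_no_R0 in Hne.
Qed.

(** Far out, [f] is below [d / 2] in absolute value at both ends of an interval of length [1]; the
    mean value theorem gives the point. *)
Lemma increment_small_slope (f f' : R -> R) :
  (forall x, is_derive f x (f' x)) -> is_lim f p_infty 0 ->
  forall d X, 0 < d -> exists x, X < x /\ Rabs (f' x) < d.
Proof.
  intros Hf Hlim d X Hd. apply is_lim_spec in Hlim.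
  assert (Hd2 : 0 < d / 2) by lra.
  destruct (Hlim (mkposreal _ Hd2)) as [Y HY]. simpl in HY.
  set (a := Rmax X Y + 1).
  assert (Ha : X < a /\ Y < a).
  { unfold a. pose proof (Rmax_l X Y). pose proof (Rmax_r X Y). lra. }
  destruct (mvt f f' a (a + 1)) as [x [Hx E]]; [lra | easy |].
  exists x. split; [lra|].
  assert (H1 := HY a). assert (H2 := HY (a + 1)).
  rewrite Rminus_0_r in H1, H2.
  replace (f' x) with (f (a + 1) + - f a) by lra.
  eapply Rle_lt_trans; [apply Rabs_triang|]. rewrite Rabs_Ropp. lra.
Qed.

(** * First integrals and the range of a solution *)

Lemma continuous_potential (c s n : R) : 0 < n -> continuous (potential c s) n.
Proof. intros Hn. eapply is_derive_continuous, is_derive_potential, Hn. Qed.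

Lemma continuous_energy (c s n : R) : 0 < n -> continuous (energy c s) n.
Proof. intros Hn. eapply is_derive_continuous, is_derive_energy, Hn. Qed.

Lemma is_lim_plus_fin (f g : R -> R) (x : Rbar) (a b : R) :
  is_lim f x a -> is_lim g x b -> is_lim (fun y => f y + g y) x (a + b).
Proof. intros Hf Hg. now apply (is_lim_plus f g x a b). Qed.

Lemma is_lim_mult_fin (f g : R -> R) (x : Rbar) (a b : R) :
  is_lim f x a -> is_lim g x b -> is_lim (fun y => f y * g y) x (a * b).
Proof. intros Hf Hg. now apply (is_lim_mult f g x a b). Qed.

(** The first equation says that [n u - c n] is constant; its limit at infinity is [- c]. *)
Lemma tw_mass (c s eps : R) (n u phi : R -> R) :
  is_tw_solution s c eps n u phi -> forall x, u x = c * (1 - / n x).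
Proof.
  intros [Sn [Su [Sphi [Hn [E1 [_ [_ [Ln [_ [Lu _]]]]]]]]]] x.
  assert (Dn := smooth_is_derive n Sn). assert (Du := smooth_is_derive u Su).
  assert (C : n x * u x + - c * n x = - c).
  { apply (derive_zero_lim (fun x => n x * u x + - c * n x)).
    - intros y. specialize (E1 y).
      assert (Dnu := is_derive_Rmult n u y _ _ (Dn y) (Du y)).
      rewrite (is_derive_unique _ _ _ Dnu) in E1.
      eapply is_derive_eq.
      + apply is_derive_Rplus; [apply Dnu | apply (is_derive_scal n), Dn].
      + lra.
    - replace (Finite (- c)) with (Finite (1 * 0 + - c * 1))
        by (f_equal; ring).
      apply is_lim_plus_fin; apply is_lim_mult_fin; try easy.
      apply is_lim_const. }
  specialize (Hn x). apply (Rmult_eq_reg_l (n x)); [|lra].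
  replace (n x * (c * (1 - / n x))) with (c * n x - c) by (field; lra). lra.
Qed.

(** The second equation says that [- c u + u^2 / 2 + s ln n + phi] is constant; its limit is [0],
    and [tw_mass] eliminates [u]. *)
Lemma tw_momentum (c s eps : R) (n u phi : R -> R) :
  is_tw_solution s c eps n u phi -> forall x, phi x = potential c s (n x).
Proof.
  intros Hsol x. assert (Hu := tw_mass _ _ _ _ _ _ Hsol x).
  destruct Hsol as
    [Sn [Su [Sphi [Hn [_ [E2 [_ [Ln [_ [Lu [_ [Lphi _]]]]]]]]]]]].
  assert (Dn := smooth_is_derive n Sn). assert (Du := smooth_is_derive u Su).
  assert (Dphi := smooth_is_derive phi Sphi).
  assert (C : - c * u x + / 2 * (u x * u x) + s * ln (n x) + phi x = 0).
  { apply (derive_zero_lim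
      (fun x => - c * u x + / 2 * (u x * u x) + s * ln (n x) + phi x)).
    - intros y. specialize (E2 y). specialize (Hn y).
      eapply is_derive_eq.
      + apply is_derive_Rplus;
          [apply is_derive_Rplus; [apply is_derive_Rplus|]|].
        * apply (is_derive_scal u), Du.
        * apply (is_derive_scal (fun x => u x * u x)).
          apply is_derive_Rmult; apply Du.
        * apply (is_derive_scal (fun x => ln (n x))), is_derive_Rcomp; [|apply Dn].
          apply is_derive_Reals, derivable_pt_lim_ln, Hn.
        * apply Dphi.
      + unfold Rdiv in E2. lra.
    - replace (Finite 0)
        with (Finite (- c * 0 + / 2 * (0 * 0) + s * ln 1 + 0))
        by (f_equal; rewrite ln_1; ring).
      assert (K := is_lim_const).
      apply is_lim_plus_fin; [apply is_lim_plus_fin;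
        [apply is_lim_plus_fin|]|]; try easy; apply is_lim_mult_fin; try easy.
      * now apply is_lim_mult_fin.
      * apply is_lim_comp_continuous; [easy|].
        eapply is_derive_continuous, is_derive_Reals, derivable_pt_lim_ln.
      lra. }
  specialize (Hn x). rewrite Hu in C. unfold potential.
  replace (phi x) with
    (c * (c * (1 - / n x)) - / 2 * (c * (1 - / n x) * (c * (1 - / n x)))
     - s * ln (n x)) by lra.
  field. lra.
Qed.

Lemma is_derive_potential_comp (c s : R) (n n' : R -> R) (x : R) :
  0 < n x -> is_derive n x (n' x) ->
  is_derive (fun y => potential c s (n y)) x (dpotential c s (n x) * n' x).
Proof.
  intros Hn Dn. rewrite Rmult_comm.
  apply (is_derive_comp (potential c s) n); [|easy].
  now apply is_derive_potential.
Qed.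

Lemma is_derive_energy_comp (c s : R) (n n' : R -> R) (x : R) :
  0 < n x -> is_derive n x (n' x) ->
  is_derive (fun y => energy c s (n y)) x (denergy c s (n x) * n' x).
Proof.
  intros Hn Dn. rewrite Rmult_comm.
  apply (is_derive_comp (energy c s) n); [|easy].
  now apply is_derive_energy.
Qed.

Lemma tw_slope (c s eps : R) (n u phi : R -> R) :
  is_tw_solution s c eps n u phi ->
  forall x, Derive phi x = dpotential c s (n x) * Derive n x.
Proof.
  intros Hsol x. assert (Hphi := tw_momentum _ _ _ _ _ _ Hsol).
  destruct Hsol as [Sn [_ [_ [Hn _]]]].
  apply is_derive_unique.
  eapply is_derive_ext; [intros y; symmetry; apply Hphi|].
  apply is_derive_potential_comp; [apply Hn | now apply smooth_is_derive].
Qed.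

(* The energy constant is [0] because [phi'] is small somewhere arbitrarily far
   out, [phi] having a limit. *)
Lemma tw_energy (c s eps : R) (n u phi : R -> R) :
  0 < eps -> is_tw_solution s c eps n u phi ->
  forall x, eps * Derive phi x ^ 2 / 2 = energy c s (n x).
Proof.
  intros He Hsol x. assert (Hphi := tw_momentum _ _ _ _ _ _ Hsol).
  assert (Hslope := tw_slope _ _ _ _ _ _ Hsol).
  destruct Hsol as
    [Sn [Su [Sphi [Hn [_ [_ [E3 [Ln [_ [Lu [_ [Lphi _]]]]]]]]]]]].
  assert (Dn := smooth_is_derive n Sn).
  assert (D2 := smooth_is_derive2 phi Sphi).
  set (f := fun x => eps / 2 * (Derive phi x * Derive phi x)
                     + - 1 * energy c s (n x)).
  assert (Df : forall y, is_derive f y 0).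
  { intros y. specialize (E3 y). eapply is_derive_eq.
    - apply is_derive_Rplus.
      + apply (is_derive_scal (fun x => Derive phi x * Derive phi x)).
        apply is_derive_Rmult; apply D2.
      + apply (is_derive_scal (fun x => energy c s (n x))).
        apply is_derive_energy_comp; [apply Hn | apply Dn].
    - unfold denergy. rewrite <- Hphi.
      replace (Derive_n phi 2 y) with ((exp (phi y) - n y) / eps)
        by (rewrite <- E3; field; lra).
      rewrite Hslope. field. lra. }
  assert (Lf : is_lim (fun x => energy c s (n x)) p_infty 0).
  { rewrite <- (energy_1 c s). apply is_lim_comp_continuous; [easy|].
    apply continuous_energy. lra. }
  assert (f x = 0).
  { destruct (Req_dec (f x) 0) as [|Hne]; [easy|exfalso].
    assert (Hpos : 0 < Rabs (f x)) by now apply Rabs_pos_lt.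
    assert (Hpos2 : 0 < Rabs (f x) / 2) by lra.
    apply is_lim_spec in Lf.
    destruct (Lf (mkposreal _ Hpos2)) as [X HX]. simpl in HX.
    (* A slope below [d <= 1] has square at most [d], so the kinetic term is at most half of
       [Rabs (f x)]; the energy term is strictly below the other half. *)
    set (d := Rmin 1 (Rabs (f x) / eps)).
    assert (Hd : 0 < d <= 1 /\ d <= Rabs (f x) / eps).
    { unfold d. assert (0 < Rabs (f x) / eps) by now apply Rdiv_lt_0_compat.
      split; [|apply Rmin_r]. split; [|apply Rmin_l].
      apply Rmin_glb_lt; lra. }
    destruct (increment_small_slope phi (Derive phi)
      (smooth_is_derive phi Sphi) Lphi d X) as [y [Hy Hyd]]; [lra|].
    specialize (HX y Hy). rewrite Rminus_0_r in HX.
    rewrite (derive_zero_const f x y Df) in *.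
    assert (Rabs (f y) <=
      eps / 2 * (Rabs (Derive phi y) * Rabs (Derive phi y)) +
      Rabs (energy c s (n y))).
    { unfold f. eapply Rle_trans; [apply Rabs_triang|].
      rewrite !Rabs_mult, (Rabs_pos_eq (eps / 2)), (Rabs_left (-1)) by lra.
      lra. }
    assert (Rabs (Derive phi y) * Rabs (Derive phi y) <= d).
    { assert (0 <= Rabs (Derive phi y)) by apply Rabs_pos. nra. }
    assert (eps * d <= Rabs (f y)).
    { destruct Hd as [_ Hd]. apply (Rmult_le_compat_l eps) in Hd; [|lra].
      replace (eps * (Rabs (f y) / eps)) with (Rabs (f y)) in Hd
        by (field; lra). easy. }
    nra. }
  unfold f in H. lra.
Qed.

(** The energy vanishes at [m] with negative derivative. The interval obtained is a barrier for
    solutions, along which the energy is nonnegative. *)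
Lemma energy_neg_right (c s m : R) :
  is_peak c s m -> exists b, m < b /\ forall n, m < n < b -> energy c s n < 0.
Proof.
  intros [H1 Hsub H0 Hexp _].
  assert (Hd : denergy c s m < 0).
  { assert (0 < dpotential c s m) by (apply dpotential_pos; lra).
    unfold denergy. nra. }
  assert (D := is_derive_energy c s m ltac:(lra)).
  apply is_derive_Reals in D.
  destruct (D (- denergy c s m)) as [d Hdd]; [lra|].
  exists (m + d). assert (Hd0 := cond_pos d). split; [lra|].
  intros n Hn. specialize (Hdd (n - m)).
  assert (K : Rabs ((energy c s (m + (n - m)) - energy c s m) / (n - m)
                    - denergy c s m) < - denergy c s m).
  { apply Hdd; [lra|]. rewrite Rabs_pos_eq; lra. }
  replace (m + (n - m)) with n in K by ring. rewrite H0, Rminus_0_r in K.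
  apply Rabs_lt_between in K.
  assert (energy c s n / (n - m) < 0) by lra.
  replace (energy c s n) with (energy c s n / (n - m) * (n - m))
    by (field; lra). nra.
Qed.

Lemma tw_profile (c s eps m : R) (n u phi : R -> R) :
  0 < eps -> 0 <= s -> 1 + s < c ^ 2 -> is_peak c s m ->
  is_tw_solution s c eps n u phi -> nontrivial n u phi ->
  (forall x, 1 <= n x <= m) /\ exists xc, n xc = m /\ Derive phi xc = 0.
Proof.
  intros He Hs Hc Hpeak Hsol Hnt.
  assert (Hu := tw_mass _ _ _ _ _ _ Hsol).
  assert (Hphi := tw_momentum _ _ _ _ _ _ Hsol).
  assert (Hslope := tw_slope _ _ _ _ _ _ Hsol).
  assert (HE := tw_energy _ _ _ _ _ _ He Hsol).
  destruct Hsol as [Sn [_ [_ [Hn [_ [_ [_ [Lp [Lm _]]]]]]]]].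
  assert (Dn := smooth_is_derive n Sn).
  assert (HE0 : forall x, 0 <= energy c s (n x)).
  { intros x. rewrite <- HE. pose proof (pow2_ge_0 (Derive phi x)). nra. }
  assert (Hcrit : forall x, Derive n x = 0 ->
            Derive phi x = 0 /\ energy c s (n x) = 0).
  { intros x Hx. assert (E : Derive phi x = 0).
    { rewrite Hslope, Hx. ring. }
    split; [easy|]. rewrite <- HE, E. field. }
  assert (H1m := peak_gt1 _ _ _ Hpeak).
  assert (Hle : forall x, n x <= m).
  { intros x. apply Rnot_lt_le. intros Hx.
    destruct (energy_neg_right c s m Hpeak) as [b [Hb Hneg]].
    apply is_lim_spec in Lp.
    assert (Hm1 : 0 < m - 1) by lra.
    destruct (Lp (mkposreal _ Hm1)) as [X HX]. simpl in HX.
    specialize (HX (X + 1) ltac:(lra)). apply Rabs_lt_between in HX.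
    (* A level inside the barrier and not above [n x]. As [n] comes below [m] far out, it must take
       the value [v], where the energy is negative. *)
    set (v := Rmin (n x) ((m + b) / 2)).
    assert (Hv : m < v /\ v <= n x /\ v <= (m + b) / 2).
    { unfold v. split; [apply Rmin_glb_lt; lra|].
      split; [apply Rmin_l | apply Rmin_r]. }
    destruct (IVT_gen n x (X + 1) v) as [z [_ Hz]].
    - intros y. eapply is_derive_continuity_pt, Dn.
    - rewrite Rmin_right, Rmax_left by lra. lra.
    - specialize (HE0 z). rewrite Hz in HE0.
      specialize (Hneg v ltac:(lra)). lra. }
  assert (Hge : forall x, 1 <= n x).
  { intros x. apply Rnot_lt_le. intros Hx.
    (* A value below [1] forces a minimum of [n] below [1]. The energy is zero at a critical point,
       but positive on [(0, 1)]. *)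
    destruct (max_attained (fun x => - n x) (fun x => - Derive n x) (- (1)) x)
      as [z [Hz Hz0]].
    - intros y. apply (is_derive_opp n), Dn.
    - now apply (is_lim_opp n p_infty 1).
    - now apply (is_lim_opp n m_infty 1).
    - lra.
    - destruct (Hcrit z) as [_ K]; [lra|].
      assert (0 < energy c s (n z)); [|lra].
      apply energy_pos_left; try easy. specialize (Hz x). split; [apply Hn | lra]. }
  split; [easy|].
  assert (exists x, 1 < n x) as [x Hx].
  { destruct Hnt as [x Hx]. exists x.
    destruct (Hge x) as [|E]; [easy|exfalso].
    rewrite Hu, Hphi, <- E, potential_1, Rinv_1 in Hx.
    destruct Hx as [Hx | [Hx | Hx]]; apply Hx; ring. }
  (* The energy vanishes at the maximum too, which exceeds [1]; as the energy is positive on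
     [(1, m)], the maximum is [m]. *)
  destruct (max_attained n (Derive n) 1 x Dn Lp Lm Hx) as [xc [Hmax H0]].
  destruct (Hcrit xc H0) as [Hp0 Hen].
  exists xc. split; [|easy].
  destruct (Hle xc) as [Hlt|]; [|easy].
  specialize (Hmax x).
  assert (0 < energy c s (n xc)); [|lra].
  apply (peak_pos _ _ _ Hpeak). lra.
Qed.

(** * Construction of the wave *)

Lemma derive_pos_incr (f f' : R -> R) (x y : R) :
  (forall z, is_derive f z (f' z)) -> (forall z, 0 < f' z) ->
  x < y -> f x < f y.
Proof.
  intros Hf Hpos Hxy.
  destruct (mvt f f' x y Hxy) as [z [_ E]]; [easy|].
  specialize (Hpos z). nra.
Qed.

Lemma derive_pos_lt_inv (f f' : R -> R) (x y : R) :
  (forall z, is_derive f z (f' z)) -> (forall z, 0 < f' z) ->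
  f x < f y -> x < y.
Proof.
  intros Hf Hpos Hxy. destruct (Rtotal_order x y) as [H | [-> | H]]; trivial.
  - lra.
  - apply (derive_pos_incr f f') in H; trivial. lra.
Qed.

(** By the mean value theorem the difference quotient of [W] is [/ T' v] with [v] between [W x] and
    [W (x + h)]. Monotonicity of [T] confines [W (x + h)] to within [d / 2] of [W x] for small
    [h]. *)
Lemma is_derive_inverse (T T' W : R -> R) :
  (forall w, is_derive T w (T' w)) -> (forall w, 0 < T' w) ->
  (forall w, continuous T' w) -> (forall x, T (W x) = x) ->
  forall x, is_derive W x (/ T' (W x)).
Proof.
  intros DT Hpos Hcont HTW x. apply is_derive_Reals. intros e He.
  assert (C : continuous (fun w => / T' w) (W x)).
  { apply continuous_Rinv_comp; [apply Hcont|]. specialize (Hpos (W x)). lra. }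
  apply (continuity_pt_filterlim (fun w => / T' w)) in C.
  destruct (C e He) as [d [Hd HC]].
  assert (Hl : T (W x - d / 2) < x).
  { rewrite <- (HTW x) at 2. apply (derive_pos_incr T T'); trivial. lra. }
  assert (Hr : x < T (W x + d / 2)).
  { rewrite <- (HTW x) at 1. apply (derive_pos_incr T T'); trivial. lra. }
  assert (Hdel : 0 < Rmin (x - T (W x - d / 2)) (T (W x + d / 2) - x)).
  { apply Rmin_glb_lt; lra. }
  exists (mkposreal _ Hdel). intros h Hh0 Hh. simpl in Hh.
  assert (Hh1 : Rabs h < x - T (W x - d / 2))
    by (eapply Rlt_le_trans; [exact Hh | apply Rmin_l]).
  assert (Hh2 : Rabs h < T (W x + d / 2) - x)
    by (eapply Rlt_le_trans; [exact Hh | apply Rmin_r]).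
  apply Rabs_lt_between in Hh1, Hh2.
  assert (H1 : W x - d / 2 < W (x + h)).
  { apply (derive_pos_lt_inv T T'); trivial. rewrite HTW. lra. }
  assert (H2 : W (x + h) < W x + d / 2).
  { apply (derive_pos_lt_inv T T'); trivial. rewrite HTW. lra. }
  destruct (MVT_gen T (W x) (W (x + h)) T') as [v [Hv E]].
  { intros w _. apply DT. }
  { intros w _. eapply is_derive_continuity_pt, DT. }
  rewrite !HTW in E.
  replace ((W (x + h) - W x) / h) with (/ T' v).
  - destruct (Req_dec (W x) v) as [<-|Hne].
    + rewrite Rminus_diag, Rabs_R0. lra.
    + apply HC. split; [split; [exact I | easy]|].
      unfold dist; simpl; unfold R_dist.
      unfold Rmin, Rmax in Hv. destruct (Rle_dec (W x) (W (x + h)));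
      apply Rabs_def1; lra.
  - replace h with (T' v * (W (x + h) - W x)) at 2 by lra.
    specialize (Hpos v). field. split; [|lra]. intros E0. rewrite E0 in E. lra.
Qed.

(** Separation of variables: [W] is the inverse of [T w], the integral of [theta] from [0] to [w].
    Evenness of [theta] makes [T] odd, and the lower bound [k] makes it onto, so that [W] is defined
    on the whole line. *)
Lemma autonomous_flow (theta : R -> R) (k M : R) :
  (forall w, continuous theta w) -> (forall w, 0 < theta w) ->
  (forall w, theta (- w) = theta w) -> 0 < k ->
  (forall w, M <= w -> k <= theta w) ->
  exists W, (forall x, is_derive W x (/ theta (W x))) /\
    (forall x, W (- x) = - W x) /\ (forall w, exists x, W x = w) /\
    is_lim W p_infty p_infty.
Proof.
  intros Hcont Hpos Heven Hk HM.
  set (T := fun w : R => RInt theta 0 w : R).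
  assert (DT : forall w, is_derive T w (theta w)).
  { intros w. apply (is_derive_RInt theta T 0); [|apply Hcont].
    apply filter_forall. intros z.
    apply (RInt_correct theta), (ex_RInt_continuous theta). intros; apply Hcont. }
  assert (T0 : T 0 = 0) by apply (RInt_point 0 theta).
  clearbody T.
  assert (Todd : forall w, T (- w) = - T w).
  { intros w.
    assert (T w + T (- w) = T 0 + T (- 0)).
    { apply (derive_zero_const (fun w => T w + T (- w))). intros z.
      eapply is_derive_eq.
      - apply is_derive_Rplus; [apply DT|].
        apply (is_derive_Rcomp T (fun y => - y) z (theta (- z)) (-1)); [apply DT|].
        auto_derive; [easy | ring].
      - rewrite Heven. ring. }
    rewrite Ropp_0, T0 in H. lra. }
  assert (Tinj : forall a b, T a = T b -> a = b).
  { intros a b E. destruct (Rtotal_order a b) as [H | [-> | H]]; trivial;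
      apply (derive_pos_incr T theta) in H; trivial; lra. }
  (* A [sig] type rather than [exists], so that [W] can be extracted as a function by
     [proj1_sig]. *)
  assert (Tbig : forall y, 0 <= y -> {b | 0 <= b /\ y <= T b}).
  { intros y Hy. set (a := Rabs M).
    assert (Ha : 0 <= a) by apply Rabs_pos.
    assert (HMa : M <= a) by apply Rle_abs. clearbody a.
    exists (a + (y / k + 1)).
    assert (Hyk : 0 <= y / k) by (apply Rdiv_le_0_compat; lra).
    split; [lra|].
    assert (HTa : 0 <= T a).
    { destruct Ha as [Ha | <-]; [|lra].
      apply (derive_pos_incr T theta) in Ha; trivial. lra. }
    destruct (mvt T theta a (a + (y / k + 1))) as [z [Hz E]]; [lra | easy |].
    specialize (HM z ltac:(lra)).
    assert (k * (y / k + 1) <= theta z * (y / k + 1))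
      by (apply Rmult_le_compat_r; lra).
    replace (k * (y / k + 1)) with (y + k) in H by (field; lra).
    replace (a + (y / k + 1) - a) with (y / k + 1) in E by ring. lra. }
  assert (Tsurj : forall y, {w | T w = y}).
  { intros y.
    destruct (Tbig (Rabs y) (Rabs_pos y)) as [b [Hb Hyb]].
    destruct (IVT_gen T (- b) b y) as [w [_ Hw]].
    - intros w. eapply is_derive_continuity_pt, DT.
    - rewrite Todd. pose proof (Rabs_pos y).
      rewrite Rmin_left, Rmax_right by lra. now apply Rabs_le_between.
    - now exists w. }
  set (W := fun y => proj1_sig (Tsurj y)).
  assert (HTW : forall x, T (W x) = x).
  { intros x. exact (proj2_sig (Tsurj x)). }
  clearbody W. exists W. split; [|split; [|split]].
  - now apply (is_derive_inverse T theta W).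
  - intros x. apply Tinj. now rewrite Todd, !HTW.
  - intros w. exists (T w). apply Tinj, HTW.
  - apply is_lim_spec. intros B. exists (T B). intros x Hx.
    apply (derive_pos_lt_inv T theta); trivial. now rewrite HTW.
Qed.

(** Near [x] the continuous function [p] keeps its sign, so it equals [sqrt (p^2)] or its opposite
    there. *)
Lemma is_derive_sqr_inv (p : R -> R) (x d : R) :
  continuous p x -> p x <> 0 ->
  is_derive (fun y => p y * p y) x (2 * p x * d) -> is_derive p x d.
Proof.
  assert (K : forall q l, continuous q x -> 0 < q x ->
    is_derive (fun y => q y * q y) x (2 * q x * l) -> is_derive q x l).
  { intros q l Hc Hq Hd.
    apply (is_derive_ext_loc (fun y => sqrt (q y * q y))).
    - assert (L : locally (q x) (fun z => 0 < z)) by now apply open_gt.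
      apply Hc in L. unfold filtermap in L.
      eapply filter_imp; [|exact L]. intros y Hy. simpl in Hy.
      apply sqrt_square. lra.
    - eapply is_derive_eq.
      + apply is_derive_sqrt; [exact Hd | nra].
      + simpl. rewrite sqrt_square by lra. field. lra. }
  intros Hc Hp Hd. destruct (Rdichotomy _ _ Hp) as [H|H].
  - apply (is_derive_ext (fun y => - - p y)); [intros; apply Ropp_involutive|].
    replace d with (- - d) by ring. apply (is_derive_opp (fun y => - p y)).
    apply K; [now apply (continuous_opp p) | lra |].
    apply (is_derive_ext (fun y => p y * p y)); [intros; symmetry; apply Rmult_opp_opp|].
    eapply is_derive_eq; [exact Hd | ring].
  - now apply K.
Qed.

(** The difference quotient at [a] is [df v] for some [v] between [a] and [a + h], and [df] is
    continuous at [a]. *)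
Lemma is_derive_extend (f df : R -> R) (a : R) :
  (forall x, x <> a -> is_derive f x (df x)) -> continuous f a ->
  continuous df a -> is_derive f a (df a).
Proof.
  intros Hf Hc Hdc. apply is_derive_Reals. intros e He.
  apply (continuity_pt_filterlim df) in Hdc.
  destruct (Hdc e He) as [d [Hd HC]].
  exists (mkposreal d Hd). intros h Hh0 Hh. simpl in Hh.
  destruct (MVT_gen f a (a + h) df) as [v [Hv E]].
  - intros x Hx. apply Hf. unfold Rmin, Rmax in Hx.
    destruct (Rle_dec a (a + h)); lra.
  - intros x _. destruct (Req_dec x a) as [->|Hne].
    + now apply (continuity_pt_filterlim f).
    + eapply is_derive_continuity_pt, Hf, Hne.
  - replace ((f (a + h) - f a) / h) with (df v)
      by (rewrite E; field; easy).
    destruct (Req_dec a v) as [<-|Hne].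
    + rewrite Rminus_diag, Rabs_R0. lra.
    + apply HC. split; [split; [exact I | easy]|].
      unfold dist; simpl; unfold R_dist.
      apply Rabs_lt_between in Hh.
      unfold Rmin, Rmax in Hv. destruct (Rle_dec a (a + h));
      apply Rabs_def1; lra.
Qed.

(** [D] is the difference quotient of [f] at [m], completed by the derivative; its continuity at [m]
    is the differentiability of [f]. *)
Lemma factor_root (f : R -> R) (m l : R) :
  is_derive f m l -> f m = 0 ->
  exists D, (forall x, f x = D x * (x - m)) /\ D m = l /\ continuous D m /\
    (forall x, x <> m -> continuous f x -> continuous D x).
Proof.
  intros Hf Hm.
  set (D := fun x => if Req_EM_T x m then l else f x / (x - m)).
  assert (HDm : D m = l) by (unfold D; destruct (Req_EM_T m m); easy).
  assert (HD : forall x, x <> m -> D x = f x / (x - m))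
    by (intros x Hx; unfold D; destruct (Req_EM_T x m); easy).
  exists D. split; [|split; [easy|split]].
  - intros x. destruct (Req_dec x m) as [->|Hx].
    + rewrite Hm. ring.
    + rewrite HD by easy. field. lra.
  - apply (continuity_pt_filterlim D). intros e He.
    apply is_derive_Reals in Hf. destruct (Hf e He) as [d Hd].
    exists d. split; [apply cond_pos|]. intros x [[_ Hx] Hxd].
    unfold dist in *; simpl in *; unfold R_dist in *.
    rewrite HDm, HD by auto.
    assert (K := Hd (x - m)). replace (m + (x - m)) with x in K by ring.
    rewrite Hm, Rminus_0_r in K. apply K; [|easy]. auto with real.
  - intros x Hx Hc. apply (continuous_ext_loc D (fun y => f y * / (y - m))).
    + assert (L : locally x (fun y => y <> m)) by now apply open_neq.
      eapply filter_imp; [|exact L]. intros y Hy. now rewrite HD.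
    + apply (continuous_mult f (fun y => / (y - m))); [easy|].
      apply (is_derive_continuous _ _ (- / (x - m) ^ 2)).
      auto_derive; [lra | field; lra].
Qed.

(** * Hyperbolic functions and continuity rules *)

Lemma cosh_sqr (x : R) : cosh x ^ 2 = 1 + sinh x ^ 2.
Proof.
  unfold cosh, sinh. rewrite exp_Ropp. field. apply Rgt_not_eq, exp_pos.
Qed.

Lemma cosh_ge_1 (x : R) : 1 <= cosh x.
Proof.
  assert (0 < cosh x).
  { unfold cosh. pose proof (exp_pos x). pose proof (exp_pos (- x)). lra. }
  pose proof (cosh_sqr x). pose proof (pow2_ge_0 (sinh x)). nra.
Qed.

Lemma cosh_even (x : R) : cosh (- x) = cosh x.
Proof. unfold cosh. rewrite Ropp_involutive. field. Qed.

Lemma cosh_lower (x : R) : (1 + x) / 2 <= cosh x.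
Proof.
  unfold cosh. pose proof (exp_ineq1_le x). pose proof (exp_pos (- x)). lra.
Qed.

Lemma sinh_pos (x : R) : 0 < x -> 0 < sinh x.
Proof. intros Hx. rewrite <- sinh_0. now apply sinh_lt. Qed.

Lemma continuous_cosh (x : R) : continuous cosh x.
Proof.
  eapply is_derive_continuous, is_derive_Reals, derivable_pt_lim_cosh.
Qed.

Lemma continuous_sinh (x : R) : continuous sinh x.
Proof.
  eapply is_derive_continuous, is_derive_Reals, derivable_pt_lim_sinh.
Qed.

Lemma continuous_Rmult (f g : R -> R) (x : R) :
  continuous f x -> continuous g x -> continuous (fun y : R => f y * g y) x.
Proof. apply (continuous_mult f g). Qed.

Lemma continuous_Rplus (f g : R -> R) (x : R) :
  continuous f x -> continuous g x -> continuous (fun y : R => f y + g y) x.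
Proof. apply (continuous_plus f g). Qed.

Lemma continuous_Rcomp (f g : R -> R) (x : R) :
  continuous g x -> continuous f (g x) -> continuous (fun y : R => f (g y)) x.
Proof. apply (continuous_comp g f). Qed.

Lemma continuous_dpotential (c s n : R) : 0 < n -> continuous (dpotential c s) n.
Proof.
  intros Hn. apply (ex_derive_continuous (dpotential c s) n).
  unfold dpotential. auto_derive. simpl. apply Rgt_not_eq.
  pose proof (pow_lt n 3 Hn). simpl in H. lra.
Qed.

(** * The profile by quadrature *)

(** [exp H - x] vanishes at [1] and is at most [A c^2 (x - 1)], while [H' <= c^2]; so [denergy]
    grows at most linearly from [n = 1]. This order of vanishing is what bounds [theta] from below
    far out, so that the wave approaches [1] only at infinity. *)
Lemma energy_quadratic (c s m : R) :
  0 <= s -> s * m ^ 2 < c ^ 2 -> exists C, 0 < C /\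
  forall n, 1 < n <= m -> energy c s n <= C * (n - 1) ^ 2.
Proof.
  intros Hs Hm. set (A := exp (potential c s m)).
  assert (HA : 0 < A) by apply exp_pos.
  assert (Hdp : forall x, 1 <= x <= m -> 0 < dpotential c s x <= c ^ 2).
  { intros x Hx. assert (x ^ 2 <= m ^ 2) by (apply pow_incr; lra).
    assert (s * x ^ 2 <= s * m ^ 2) by (apply Rmult_le_compat_l; lra).
    split; [apply dpotential_pos; lra|].
    unfold dpotential. assert (1 <= x ^ 3) by (apply pow_R1_Rle; lra).
    apply (Rmult_le_reg_r (x ^ 3)); [lra|].
    unfold Rdiv. rewrite Rmult_assoc, Rinv_l, Rmult_1_r by lra.
    assert (0 <= s * x ^ 2)
      by (apply Rmult_le_pos; [lra | apply pow2_ge_0]).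
    pose proof (pow2_ge_0 c). nra. }
  exists (c ^ 2 * (A * c ^ 2) + 1). split.
  { pose proof (pow2_ge_0 c). assert (0 <= c ^ 2 * (A * c ^ 2)); [|lra].
    apply Rmult_le_pos; [lra | apply Rmult_le_pos; lra]. }
  intros n Hn.
  assert (Hexp : forall x, 1 < x <= m ->
            exp (potential c s x) - x <= A * c ^ 2 * (x - 1)).
  { intros x Hx.
    destruct (mvt (fun y => exp (potential c s y))
      (fun y => exp (potential c s y) * dpotential c s y) 1 x)
      as [y [Hy Ey]]; [lra | |].
    - intros y Hy. apply is_derive_Rcomp; [apply is_derive_exp|].
      apply is_derive_potential. lra.
    - rewrite potential_1, exp_0 in Ey.
      assert (exp (potential c s y) < A).
      { apply exp_increasing, (potential_incr c s m); lra. }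
      destruct (Hdp y) as [H1 H2]; [lra|].
      assert (exp (potential c s y) * dpotential c s y <= A * c ^ 2).
      { apply Rmult_le_compat; try lra. apply Rlt_le, exp_pos. }
      nra. }
  destruct (energy_increment c s 1 n) as [x [Hx E]]; [lra|].
  rewrite energy_1, Rminus_0_r in E. rewrite E.
  specialize (Hexp x ltac:(lra)). destruct (Hdp x) as [H1 H2]; [lra|].
  pose proof (pow2_ge_0 c).
  assert (0 <= A * c ^ 2) by (apply Rmult_le_pos; lra).
  assert (denergy c s x <= c ^ 2 * (A * c ^ 2) * (n - 1)).
  { unfold denergy.
    apply Rle_trans with (dpotential c s x * (A * c ^ 2 * (n - 1))).
    - apply Rmult_le_compat_l; [lra|].
      apply Rle_trans with (1 := Hexp). apply Rmult_le_compat_l; lra.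
    - rewrite (Rmult_assoc (c ^ 2)). apply Rmult_le_compat_r; [|lra].
      apply Rmult_le_pos; lra. }
  pose proof (pow2_ge_0 (n - 1)). nra.
Qed.

(* Writing [n = 1 + (m - 1) / cosh w] turns the energy equation
   [eps * (H'(n) n')^2 / 2 = energy n], whose square root degenerates both at
   [n = 1] and at [n = m], into [w' = 1 / theta w] with [theta] continuous,
   positive and bounded away from [0]; the zero of the energy at [m] is
   divided out by [D]. *)
Lemma profile_exists (c s eps m : R) :
  0 < eps -> 0 <= s -> is_peak c s m ->
  exists n n' : R -> R,
    (forall x, is_derive n x (n' x)) /\ (forall x, continuous n' x) /\
    (forall x, n (- x) = n x) /\ n 0 = m /\ n' 0 = 0 /\
    (forall x, 1 < n x <= m) /\ (forall x, 0 < x -> n' x < 0) /\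
    (forall x, x <> 0 -> n' x <> 0) /\ is_lim n p_infty 1 /\
    (forall x, eps * (dpotential c s (n x) * n' x) ^ 2 / 2 = energy c s (n x)).
Proof.
  intros He Hs [H1 Hsub H0 Hexp Hpos].
  destruct (factor_root (energy c s) m (denergy c s m)) as [D [HD [HDm [HcDm HcD]]]].
  { apply is_derive_energy. lra. }
  { easy. }
  assert (HDneg : forall n, 1 < n <= m -> 0 < - D n).
  { intros n [Hn [Hnm | ->]].
    - specialize (Hpos n (conj Hn Hnm)). rewrite HD in Hpos. nra.
    - rewrite HDm. unfold denergy.
      assert (0 < dpotential c s m) by (apply dpotential_pos; lra). nra. }
  assert (HDc : forall n, 1 < n <= m -> continuous D n).
  { intros n [Hn [Hnm | ->]]; [|easy].
    apply HcD; [lra|]. apply continuous_energy. lra. }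
  set (N := fun w => 1 + (m - 1) * / cosh w).
  assert (HN : forall w, 1 < N w <= m).
  { intros w. unfold N. pose proof (cosh_ge_1 w).
    assert (0 < / cosh w) by (apply Rinv_0_lt_compat; lra).
    assert (/ cosh w <= 1) by (rewrite <- Rinv_1; apply Rinv_le_contravar; lra).
    split; nra. }
  set (N' := fun w => - (m - 1) * sinh w * / cosh w ^ 2).
  assert (DN : forall w, is_derive N w (N' w)).
  { intros w. pose proof (cosh_ge_1 w).
    assert (K : is_derive (fun y => / cosh y) w (- sinh w / cosh w ^ 2)).
    { apply is_derive_inv; [|lra].
      apply is_derive_Reals, derivable_pt_lim_cosh. }
    eapply is_derive_eq.
    - apply is_derive_Rplus; [apply is_derive_const|].
      apply (is_derive_scal (fun y => / cosh y)), K.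
    - unfold zero, N'; simpl. field. lra. }
  assert (CN : forall w, continuous N w).
  { intros w. eapply is_derive_continuous, DN. }
  (* This is [eps N'^2 / (2 energy (N w))] after cancelling the factor [cosh w - 1], common to
     [sinh^2 w] and [m - N w], which vanishes at [w = 0]. The energy equation then reads
     [(H' w')^2 Q = 1]. *)
  set (Q := fun w => eps * (m - 1) * (cosh w + 1) *
                     / (2 * cosh w ^ 3 * - D (N w))).
  assert (HQ : forall w, 0 < Q w).
  { intros w. pose proof (cosh_ge_1 w). unfold Q.
    apply Rdiv_lt_0_compat.
    - apply Rmult_lt_0_compat; [apply Rmult_lt_0_compat|]; lra.
    - apply Rmult_lt_0_compat; [|now apply HDneg].
      apply Rmult_lt_0_compat; [lra|]. apply pow_lt. lra. }
  assert (Hdp : forall w, 0 < dpotential c s (N w)).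
  { intros w. specialize (HN w).
    assert (N w ^ 2 <= m ^ 2) by (apply pow_incr; lra).
    apply dpotential_pos; [lra|].
    assert (s * N w ^ 2 <= s * m ^ 2) by (apply Rmult_le_compat_l; lra). lra. }
  set (theta := fun w => dpotential c s (N w) * sqrt (Q w)).
  assert (Htheta : forall w, 0 < theta w).
  { intros w. apply Rmult_lt_0_compat; [apply Hdp | apply sqrt_lt_R0, HQ]. }
  assert (Ceven : forall w, N (- w) = N w).
  { intros w. unfold N. now rewrite cosh_even. }
  assert (Ctheta : forall w, continuous theta w).
  { intros w. specialize (HN w). pose proof (cosh_ge_1 w).
    apply continuous_Rmult.
    - apply (continuous_Rcomp (dpotential c s) N); [apply CN|].
      apply continuous_dpotential. lra.
    - apply continuous_sqrt_comp. apply continuous_Rmult.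
      + apply continuous_Rmult; [apply continuous_const|].
        apply continuous_Rplus; [apply continuous_cosh | apply continuous_const].
      + apply continuous_Rinv_comp.
        * apply continuous_Rmult.
          -- apply continuous_Rmult; [apply continuous_const|].
             apply (continuous_Rcomp (fun y => y ^ 3) cosh);
               [apply continuous_cosh|].
             apply (ex_derive_continuous (fun y : R => y ^ 3)). auto_derive. easy.
          -- apply (continuous_opp (fun y => D (N y))).
             apply (continuous_Rcomp D N); [apply CN | now apply HDc].
        * apply Rgt_not_eq. apply Rmult_lt_0_compat; [|now apply HDneg].
          apply Rmult_lt_0_compat; [lra|]. apply pow_lt. lra. }
  destruct (energy_quadratic c s m Hs Hsub) as [C [HC HCn]].
  set (h := (c ^ 2 - s * m ^ 2) / m ^ 3).
  assert (Hh : 0 < h) by (apply (dpotential_pos c s m); lra).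
  assert (Hsq : 0 < sqrt (eps / (4 * C))).
  { apply sqrt_lt_R0, Rdiv_lt_0_compat; lra. }
  (* [h] bounds [dpotential] from below on [[1, m]], and [eps / (4 C)] bounds [Q] from below. The
     threshold [3] ensures [cosh w >= 2]. *)
  destruct (autonomous_flow theta (h * sqrt (eps / (4 * C))) 3)
    as [W [DW [Wodd [Wsurj Wlim]]]].
  { easy. }
  { easy. }
  { intros w. unfold theta, Q. now rewrite Ceven, cosh_even. }
  { now apply Rmult_lt_0_compat. }
  { intros w Hw. unfold theta. pose proof (HN w) as HNw.
    apply Rmult_le_compat; [lra | lra | |].
    - apply dpotential_lower; lra.
    - apply sqrt_le_1_alt.
      assert (Hch : 2 <= cosh w) by (pose proof (cosh_lower w); lra).
      specialize (HDneg _ HNw). specialize (HCn _ HNw). rewrite HD in HCn.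
      set (a := - D (N w)) in *.
      replace (D (N w) * (N w - m)) with (a * (m - N w)) in HCn
        by (unfold a; ring).
      unfold N in HCn.
      replace (m - (1 + (m - 1) * / cosh w))
        with ((m - 1) * (cosh w - 1) / cosh w) in HCn by (field; lra).
      replace (1 + (m - 1) * / cosh w - 1)
        with ((m - 1) / cosh w) in HCn by (field; lra).
      assert (K : a * (cosh w - 1) * cosh w <= C * (m - 1)).
      { apply (Rmult_le_reg_r ((m - 1) / cosh w ^ 2)).
        - apply Rdiv_lt_0_compat; [lra | apply pow_lt; lra].
        - replace (a * (cosh w - 1) * cosh w * ((m - 1) / cosh w ^ 2))
            with (a * ((m - 1) * (cosh w - 1) / cosh w)) by (field; lra).
          replace (C * (m - 1) * ((m - 1) / cosh w ^ 2))
            with (C * ((m - 1) / cosh w) ^ 2) by (field; lra). easy. }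
      (* From [cosh w >= 2] follows [cosh w - 1 >= cosh w / 2]. *)
      assert (K2 : a * cosh w ^ 2 <= 2 * (C * (m - 1))).
      { assert (0 <= a * cosh w * (cosh w - 2))
          by (apply Rmult_le_pos; [apply Rmult_le_pos|]; lra). nra. }
      assert (P : 0 < 2 * cosh w ^ 3 * a).
      { apply Rmult_lt_0_compat; [|lra].
        apply Rmult_lt_0_compat; [lra|]. apply pow_lt. lra. }
      unfold Q. fold a.
      apply (Rmult_le_reg_r (2 * cosh w ^ 3 * a)); [lra|].
      replace (eps * (m - 1) * (cosh w + 1) * / (2 * cosh w ^ 3 * a) *
        (2 * cosh w ^ 3 * a)) with (eps * (m - 1) * (cosh w + 1))
        by (field; repeat split; lra).
      apply Rle_trans with (eps * (m - 1) * cosh w);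
        [|apply Rmult_le_compat_l; [apply Rmult_le_pos|]; lra].
      replace (eps / (4 * C) * (2 * cosh w ^ 3 * a))
        with (eps / (2 * C) * cosh w * (a * cosh w ^ 2)) by (field; lra).
      replace (eps * (m - 1) * cosh w)
        with (eps / (2 * C) * cosh w * (2 * (C * (m - 1)))) by (field; lra).
      apply Rmult_le_compat_l; [|easy].
      apply Rmult_le_pos; [|lra].
      apply Rlt_le, Rdiv_lt_0_compat; lra. }
  assert (W0 : W 0 = 0).
  { specialize (Wodd 0). rewrite Ropp_0 in Wodd. lra. }
  assert (Hinv : forall w, 0 < / theta w).
  { intros w. apply Rinv_0_lt_compat, Htheta. }
  assert (Wpos : forall x, 0 < x -> 0 < W x).
  { intros x Hx. rewrite <- W0.
    apply (derive_pos_incr W (fun x => / theta (W x))); trivial. }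
  assert (N'neg : forall w, 0 < w -> N' w < 0).
  { intros w Hw. unfold N'. pose proof (cosh_ge_1 w).
    assert (0 < (m - 1) * sinh w * / cosh w ^ 2); [|lra].
    apply Rdiv_lt_0_compat; [|apply pow_lt; lra].
    apply Rmult_lt_0_compat; [lra | now apply sinh_pos]. }
  assert (N'odd : forall w, N' (- w) = - N' w).
  { intros w. unfold N'. rewrite cosh_even. unfold sinh.
    rewrite Ropp_involutive. field. pose proof (cosh_ge_1 w). lra. }
  assert (CW : forall x, continuous W x).
  { intros x. eapply is_derive_continuous, DW. }
  assert (Hn'neg : forall x, 0 < x -> N' (W x) * / theta (W x) < 0).
  { intros x Hx. specialize (N'neg _ (Wpos x Hx)). specialize (Hinv (W x)). nra. }
  exists (fun x => N (W x)), (fun x => N' (W x) * / theta (W x)).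
  split; [|split; [|split; [|split; [|split; [|split; [|split; [|split; [|split]]]]]]]].
  - intros x. now apply is_derive_Rcomp.
  - intros x. apply (continuous_Rcomp (fun w => N' w * / theta w) W); [easy|].
    pose proof (cosh_ge_1 (W x)).
    apply continuous_Rmult; [apply continuous_Rmult|].
    + apply continuous_Rmult; [apply continuous_const | apply continuous_sinh].
    + apply continuous_Rinv_comp.
      * apply (continuous_Rcomp (fun y => y ^ 2) cosh);
          [apply continuous_cosh|].
        apply (ex_derive_continuous (fun y : R => y ^ 2)). auto_derive. easy.
      * apply pow_nonzero. lra.
    + apply continuous_Rinv_comp; [easy|]. apply Rgt_not_eq, Htheta.
  - intros x. now rewrite Wodd, Ceven.
  - rewrite W0. unfold N. rewrite cosh_0. field.
  - rewrite W0. unfold N'. rewrite sinh_0. ring.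
  - intros x. apply HN.
  - easy.
  - intros x Hx. destruct (Rdichotomy _ _ Hx) as [H|H].
    + specialize (Hn'neg (- x) ltac:(lra)). rewrite Wodd in Hn'neg.
      rewrite N'odd in Hn'neg.
      replace (theta (- W x)) with (theta (W x)) in Hn'neg
        by (unfold theta, Q; now rewrite Ceven, cosh_even). lra.
    + specialize (Hn'neg x H). lra.
  - apply is_lim_spec. intros [e Hee]. simpl.
    (* Since [cosh w >= (1 + w) / 2], the bound [W x > 2 (m - 1) / e] gives
       [(m - 1) / cosh (W x) < e]. *)
    apply is_lim_spec in Wlim. destruct (Wlim (2 * (m - 1) / e)) as [X HX].
    exists X. intros x Hx. specialize (HX x Hx).
    pose proof (cosh_lower (W x)). pose proof (cosh_ge_1 (W x)).
    unfold N. replace (1 + (m - 1) * / cosh (W x) - 1)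
      with ((m - 1) / cosh (W x)) by (field; lra).
    rewrite Rabs_pos_eq by (apply Rlt_le, Rdiv_lt_0_compat; lra).
    apply (Rmult_lt_reg_r (cosh (W x))); [lra|].
    replace ((m - 1) / cosh (W x) * cosh (W x)) with (m - 1) by (field; lra).
    replace (m - 1) with (e * (2 * (m - 1) / e / 2)) by (field; lra).
    apply Rmult_lt_compat_l; lra.
  - intros x. set (w := W x). specialize (HQ w). specialize (Hdp w).
    assert (Hs2 : sqrt (Q w) ^ 2 = Q w) by (apply pow2_sqrt; lra).
    assert (Hs0 : 0 < sqrt (Q w)) by now apply sqrt_lt_R0.
    unfold theta.
    replace (dpotential c s (N w) *
              (N' w * / (dpotential c s (N w) * sqrt (Q w))))
      with (N' w * / sqrt (Q w)) by (field; lra).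
    rewrite Rpow_mult_distr, pow_inv, Hs2, HD.
    specialize (HDneg _ (HN w)). pose proof (cosh_ge_1 w).
    assert (Hsh : sinh w ^ 2 = cosh w ^ 2 - 1) by (rewrite cosh_sqr; ring).
    replace (N' w ^ 2) with ((m - 1) ^ 2 * sinh w ^ 2 * / cosh w ^ 4)
      by (unfold N'; field; lra).
    rewrite Hsh. unfold Q. set (a := D (N w)) in *. unfold N.
    field. repeat split; lra.
Qed.

(* Away from [0] this is the differentiated energy equation; there [p] vanishes
   only at [0], where the derivative is recovered as a limit. *)
Lemma energy_second_order (c s eps : R) (n n' : R -> R) :
  0 < eps -> (forall x, 0 < n x) -> (forall x, is_derive n x (n' x)) ->
  (forall x, continuous n' x) ->
  (forall x, x <> 0 -> dpotential c s (n x) * n' x <> 0) ->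
  (forall x, eps * (dpotential c s (n x) * n' x) ^ 2 / 2 = energy c s (n x)) ->
  forall x, is_derive (fun y => dpotential c s (n y) * n' y) x
              ((exp (potential c s (n x)) - n x) / eps).
Proof.
  intros He Hn Dn Cn' Hnz HE.
  assert (Cn : forall x, continuous n x).
  { intros x. eapply is_derive_continuous, Dn. }
  set (p := fun y => dpotential c s (n y) * n' y) in *.
  set (F := fun x => (exp (potential c s (n x)) - n x) / eps).
  assert (Cp : forall x, continuous p x).
  { intros x. apply continuous_Rmult; [|apply Cn'].
    apply (continuous_Rcomp (dpotential c s) n); [apply Cn|].
    apply continuous_dpotential, Hn. }
  assert (CF : forall x, continuous F x).
  { intros x. apply continuous_Rmult; [|apply continuous_const].
    apply (continuous_minus (fun y => exp (potential c s (n y))) n); [|apply Cn].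
    apply continuous_exp_comp.
    apply (continuous_Rcomp (potential c s) n); [apply Cn|].
    apply continuous_potential, Hn. }
  assert (DF : forall x, x <> 0 -> is_derive p x (F x)).
  { intros x Hx. apply is_derive_sqr_inv; [apply Cp | now apply Hnz|].
    (* By the energy equation this is [p^2]. Its derivative is [2 p F], as [denergy] contains the
       factor [exp H - n]. *)
    apply (is_derive_ext (fun y => 2 / eps * energy c s (n y))).
    - intros y. rewrite <- HE. change (dpotential c s (n y) * n' y) with (p y).
      simpl. field. lra.
    - eapply is_derive_eq.
      + apply (is_derive_scal (fun y => energy c s (n y))).
        apply is_derive_energy_comp; [apply Hn | apply Dn].
      + unfold denergy, F, p. field. lra. }
  intros x. change (is_derive p x (F x)).
  destruct (Req_dec x 0) as [->|Hx]; [|now apply DF].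
  now apply is_derive_extend.
Qed.

(** * Smoothness, symmetry and translation *)

(** Bootstrap: [n' = p n^3 / (c^2 - s n^2)], [phi' = p] and [p' = (exp phi - n) / eps] are built
    from the three functions themselves, so order [k] for all three yields order [k + 1]. The
    subsonic bound keeps the denominator away from zero. *)
Lemma system_smooth (c s eps : R) (n n' phi p : R -> R) :
  (forall x, 0 < n x) -> (forall x, s * n x ^ 2 < c ^ 2) ->
  (forall x, is_derive n x (n' x)) ->
  (forall x, is_derive phi x (p x)) ->
  (forall x, p x = dpotential c s (n x) * n' x) ->
  (forall x, is_derive p x ((exp (phi x) - n x) / eps)) ->
  forall k, differentiable_n k n /\ differentiable_n k phi /\
            differentiable_n k p.
Proof.
  intros Hn Hsub Dn Dphi Hp Dp.
  induction k as [|k [IHn [IHphi IHp]]]; [easy|].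
  split; [|split].
  - exists (fun x => p x * (n x * (n x * n x) *
                            / (c ^ 2 + - s * (n x * n x)))).
    split.
    + intros x. eapply is_derive_eq; [apply Dn|].
      specialize (Hn x). specialize (Hsub x).
      rewrite Hp. unfold dpotential. field. split; [|lra]. simpl in Hsub. lra.
    + repeat apply differentiable_n_mult; trivial.
      apply differentiable_n_inv.
      * intros x. specialize (Hsub x). simpl in Hsub. lra.
      * apply differentiable_n_plus; [apply differentiable_n_const|].
        repeat apply differentiable_n_mult; trivial.
        apply differentiable_n_const.
  - now exists p.
  - exists (fun x => (exp (phi x) + -1 * n x) * / eps). split.
    + intros x. eapply is_derive_eq; [apply Dp|]. unfold Rdiv. ring.
    + apply differentiable_n_mult; [|apply differentiable_n_const].
      apply differentiable_n_plus; [now apply differentiable_n_exp|].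
      apply differentiable_n_mult; [apply differentiable_n_const | easy].
Qed.

Lemma is_lim_even (f : R -> R) (l : Rbar) :
  (forall x, f (- x) = f x) -> is_lim f p_infty l -> is_lim f m_infty l.
Proof.
  intros Hf Hl. apply (is_lim_ext (fun x => f (- x))); [easy|].
  apply (is_lim_comp f Ropp m_infty l p_infty); [easy | |].
  - apply (is_lim_opp (fun x => x) m_infty m_infty), is_lim_id.
  - now exists 0.
Qed.

Lemma is_derive_translate (f : R -> R) (a x l : R) :
  is_derive f (x - a) l -> is_derive (fun y => f (y - a)) x l.
Proof.
  intros Hf. eapply is_derive_eq.
  - apply (is_derive_Rcomp f (fun y => y - a) x l 1 Hf). auto_derive; [easy|ring].
  - ring.
Qed.

(** * Assembly of existence, uniqueness and the shape of the wave *)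

Theorem theorem1p1 (sigma V gamma eps : R) :
  0 <= sigma -> 0 < V -> 0 < gamma -> 0 < eps ->
  speed_condition sigma (V + gamma * eps) ->
  exists n u phi : R -> R,
    is_tw_solution sigma (V + gamma * eps) eps n u phi /\ nontrivial n u phi /\
    (* uniqueness up to translation *)
    (forall n2 u2 phi2 : R -> R,
        is_tw_solution sigma (V + gamma * eps) eps n2 u2 phi2 ->
        nontrivial n2 u2 phi2 ->
        exists xc, forall x,
          n2 x = n (x - xc) /\ u2 x = u (x - xc) /\ phi2 x = phi (x - xc)) /\
    (* (i) evenness *)
    (forall x, n x = n (- x) /\ u x = u (- x) /\ phi x = phi (- x)) /\
    (* (ii) strict decrease on (0, oo) *)
    (forall x, 0 < x -> Derive n x < 0 /\ Derive u x < 0 /\ Derive phi x < 0) /\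
    (* (iii) maxima at 0 *)
    (forall x, n x <= n 0 /\ u x <= u 0 /\ phi x <= phi 0) /\
    (* (iv) positivity *)
    (forall x, 1 < n x /\ 0 < u x /\ 0 < phi x).
Proof.
  intros Hs HV Hg He Hspeed.
  assert (Hc : 0 < V + gamma * eps) by nra.
  revert Hspeed Hc. generalize (V + gamma * eps). clear V gamma HV Hg.
  rename sigma into s. intros c Hspeed Hc0.
  destruct (speed_condition_peak c s Hc0 Hs Hspeed) as [Hc [m Hpeak]].
  assert (Hm := peak_gt1 _ _ _ Hpeak).
  assert (Hsub := peak_subsonic _ _ _ Hpeak).
  destruct (profile_exists c s eps m He Hs Hpeak)
    as [n [n' [Dn [Cn' [Heven [Hn0 [Hn'0 [Hn1m [Hdecr [Hn'nz [Hlim HE]]]]]]]]]]].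
  assert (Hnpos : forall x, 0 < n x) by (intros x; specialize (Hn1m x); lra).
  assert (Hnsub : forall x, s * n x ^ 2 < c ^ 2).
  { intros x. specialize (Hn1m x).
    assert (n x ^ 2 <= m ^ 2) by (apply pow_incr; lra).
    assert (s * n x ^ 2 <= s * m ^ 2) by (apply Rmult_le_compat_l; lra). lra. }
  assert (Hdp : forall x, 0 < dpotential c s (n x)).
  { intros x. now apply dpotential_pos. }
  set (u := fun x => c * (1 - / n x)).
  set (phi := fun x => potential c s (n x)).
  set (p := fun x => dpotential c s (n x) * n' x).
  assert (Dphi : forall x, is_derive phi x (p x)).
  { intros x. now apply is_derive_potential_comp. }
  assert (Dp : forall x, is_derive p x ((exp (phi x) - n x) / eps)).
  { apply energy_second_order; trivial.
    intros x Hx. apply Rmult_integral_contrapositive_currified;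
      [apply Rgt_not_eq, Hdp | now apply Hn'nz]. }
  assert (Du : forall x, is_derive u x (c * n' x / n x ^ 2)).
  { intros x. specialize (Hnpos x). unfold u. eapply is_derive_eq.
    - apply (is_derive_scal (fun y => 1 - / n y)).
      apply (is_derive_minus (fun _ => 1) (fun y => / n y)).
      + apply is_derive_const.
      + apply is_derive_inv; [apply Dn | lra].
    - unfold minus, plus, opp, zero; simpl. field. lra. }
  assert (Smooth := system_smooth c s eps n n' phi p Hnpos Hnsub Dn Dphi
                      (fun x => eq_refl) Dp).
  assert (En : forall x, Derive n x = n' x)
    by (intros x; apply is_derive_unique, Dn).
  assert (Eu : forall x, Derive u x = c * n' x / n x ^ 2)
    by (intros x; apply is_derive_unique, Du).
  assert (Ephi : forall x, Derive phi x = p x)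
    by (intros x; apply is_derive_unique, Dphi).
  assert (Hlimu : is_lim u p_infty 0).
  { replace (Finite 0) with (Finite (c * (1 - / 1))) by (f_equal; field).
    apply (is_lim_comp_continuous n (fun z => c * (1 - / z))); [easy|].
    apply (ex_derive_continuous (fun z : R => c * (1 - / z))).
    auto_derive. lra. }
  assert (Hlimphi : is_lim phi p_infty 0).
  { rewrite <- (potential_1 c s).
    apply (is_lim_comp_continuous n (potential c s)); [easy|].
    apply continuous_potential. lra. }
  assert (Hueven : forall x, u (- x) = u x)
    by (intros x; unfold u; now rewrite Heven).
  assert (Hphieven : forall x, phi (- x) = phi x)
    by (intros x; unfold phi; now rewrite Heven).
  assert (Hpos : forall x, 1 < n x /\ 0 < u x /\ 0 < phi x).
  { intros x. specialize (Hn1m x). split; [easy|split].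
    - unfold u. apply Rmult_lt_0_compat; [easy|].
      assert (/ n x < / 1) by (apply Rinv_lt_contravar; lra).
      rewrite Rinv_1 in H. lra.
    - unfold phi. rewrite <- (potential_1 c s).
      apply (potential_incr c s m); lra. }
  exists n, u, phi.
  split; [|split; [|split; [|split; [|split; [|split]]]]].
  - split; [|split; [|split; [|split; [|split; [|split; [|split;
      [|split; [|split; [|split; [|split; [|split]]]]]]]]]]].
    + apply differentiable_n_smooth. intros k. apply Smooth.
    + apply differentiable_n_smooth. intros k.
      apply differentiable_n_mult; [apply differentiable_n_const|].
      apply (differentiable_n_plus k (fun _ => 1) (fun x => - / n x)).
      * apply differentiable_n_const.
      * apply differentiable_n_opp, differentiable_n_inv; [|apply Smooth].
        intros x. apply Rgt_not_eq, Hnpos.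
    + apply differentiable_n_smooth. intros k. apply Smooth.
    + easy.
    + intros x. rewrite (is_derive_unique _ _ _
        (is_derive_Rmult n u x _ _ (Dn x) (Du x))), En.
      unfold u. field. specialize (Hnpos x). lra.
    + intros x. rewrite En, Eu, Ephi. unfold u, p, dpotential. field.
      specialize (Hnpos x). lra.
    + intros x. replace (Derive_n phi 2 x) with ((exp (phi x) - n x) / eps).
      * field. lra.
      * symmetry. apply is_derive_unique.
        apply (is_derive_ext p); [intros y; symmetry; apply Ephi | apply Dp].
    + easy.
    + now apply is_lim_even.
    + easy.
    + now apply is_lim_even.
    + easy.
    + now apply is_lim_even.
  - exists 0. left. lra.
  - intros n2 u2 phi2 Hsol Hnt.
    destruct (tw_profile c s eps m n2 u2 phi2 He Hs Hc Hpeak Hsol Hnt)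
      as [Hn2 [xc [Hxc Hxc']]].
    assert (Hu2 := tw_mass _ _ _ _ _ _ Hsol).
    assert (Hphi2 := tw_momentum _ _ _ _ _ _ Hsol).
    destruct Hsol as [_ [_ [Sphi2 [_ [_ [_ [E3 _]]]]]]].
    exists xc.
    assert (Heq : forall x, n2 x = n (x - xc)).
    { apply (tw_ode_unique c s eps m xc n2 phi2 (Derive phi2)
        (fun x => n (x - xc)) (fun x => phi (x - xc)) (fun x => p (x - xc)));
        trivial.
      - intros x. specialize (Hn1m (x - xc)). lra.
      - now apply smooth_is_derive.
      - intros x. apply is_derive_translate, Dphi.
      - intros x. eapply is_derive_eq; [now apply smooth_is_derive2|].
        rewrite <- E3. field. lra.
      - intros x. apply (is_derive_translate p), Dp.
      - now rewrite Rminus_diag, Hn0.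
      - rewrite Rminus_diag, Hxc'. unfold p. rewrite Hn'0. ring. }
    intros x. split; [easy|].
    rewrite Hu2, Hphi2, Heq. easy.
  - intros x. now rewrite Heven, Hueven, Hphieven.
  - intros x Hx. specialize (Hdecr x Hx). specialize (Hdp x).
    assert (0 < n x ^ 2) by (apply pow_lt, Hnpos).
    rewrite En, Eu, Ephi. split; [easy|split].
    + assert (0 < c * - n' x / n x ^ 2).
      { apply Rdiv_lt_0_compat; [apply Rmult_lt_0_compat|]; lra. }
      replace (c * n' x / n x ^ 2) with (- (c * - n' x / n x ^ 2))
        by (field; specialize (Hnpos x); lra). lra.
    + unfold p. nra.
  - intros x. unfold u, phi. rewrite Hn0. specialize (Hn1m x).
    split; [easy|split].
    + apply Rmult_le_compat_l; [lra|].
      assert (/ m <= / n x) by (apply Rinv_le_contravar; lra). lra.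
    + destruct (proj2 Hn1m) as [Hlt | ->]; [|apply Rle_refl].
      apply Rlt_le, (potential_incr c s m); lra.
  - easy.
Qed.
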